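(* Let $p$ be an odd prime, $K$ a finite extension of $\mathbb{Q}_p$ with ring of integers $O_K$, maximal ideal $\mathfrak{p}_K$ and residue degree $f$ over $\mathbb{Q}_p$. Let $n \geq 2$, let $\pi_1, \dots, \pi_n$ be generators of $\mathfrak{p}_K$, and for each $1 \le i \le n$ let $\mathfrak{F}_i$ be a $\pi_i$-unramified group law defined over $O_K$, all of the same height $h$. Assume that $h \mid f$. Put $q = p^h$ and $K_1 = K(\mu_{(q-1)(p^f-1)})$. Then $$K_1(\mathfrak{F}_1[\pi_1]) = \cdots = K_1(\mathfrak{F}_n[\pi_n]) = K_1(\mathfrak{F}_1[\pi_1], \dots, \mathfrak{F}_n[\pi_n]).$$
   Context: Fix an algebraic closure $\overline{\mathbb{Q}}_p$ of $\mathbb{Q}_p$ containing $K$, with the absolute value $|\cdot|_p$ extended to it; $\overline{\mathfrak{p}}$ is the maximal ideal of the ring of integers of $\overline{\mathbb{Q}}_p$. For $m \ge 1$, $\mu_m$ is the group of $m$-th roots of unity in $\overline{\mathbb{Q}}_p$. Let $\pi$ be a generator of $\mathfrak{p}_K$ and let $R$ be the ring of integers of $\mathbb{Q}_p(\pi)$. A one-dimensional commutative formal group law $\mathfrak{F}$ over $O_K$ is called $\pi$-unramified if it has a formal $R$-module structure, i.e. a ring homomorphism $R \to \mathrm{End}_{O_K}(\mathfrak{F})$, $a \mapsto [a](X) \in O_K[[X]]$, with $[a](X) = aX + (\text{higher degree terms})$. Writing $[\pi](X) = \pi X + a_2X^2 + a_3X^3 + \cdots$, $\mathfrak{F}$ is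 said to have height $h$ ($h$ a positive integer) if $\min\{i \ge 2 : |a_i|_p = 1\} = p^h$. Such an $\mathfrak{F}$ makes $\overline{\mathfrak{p}}$ into an $R$-module; $\mathfrak{F}[\pi]$ denotes its $\pi$-torsion submodule $\{x \in \overline{\mathfrak{p}} : [\pi](x) = 0\}$. For a subfield $L$ of $\overline{\mathbb{Q}}_p$, $L(\mathfrak{F}_1[\pi_1], \dots)$ is the subfield of $\overline{\mathbb{Q}}_p$ generated over $L$ by the listed torsion sets. *)

(* Defs.v *)
From HB Require Import structures.
From mathcomp Require Import all_boot all_order all_algebra all_field.
From mathcomp Require Import mpoly.
From mathcomp Require Import boolp classical_sets reals topology normedtype.
From mathcomp Require Import sequences.

Set Implicit Arguments.
Unset Strict Implicit.
Unset Printing Implicit Defensive.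

Import Order.TTheory GRing.Theory Num.Theory.
Import numFieldNormedType.Exports.

Local Open Scope classical_set_scope.
Local Open Scope ring_scope.

Definition absolute_value (R : realType) (F : fieldType) (abs : F -> R) :=
  [/\ forall x, 0 <= abs x,
      forall x, abs x = 0 <-> x = 0,
      forall x y, abs (x * y) = abs x * abs y
    & forall x y, abs (x + y) <= Num.max (abs x) (abs y)].

Definition tends_to (R : realType) (F : fieldType) (abs : F -> R)
    (u : nat -> F) (l : F) :=
  (fun n => abs (u n - l)) @ \oo --> (0 : R).

Definition abs_complete (R : realType) (F : fieldType) (abs : F -> R) :=
  forall u : nat -> F,
    (forall e : R, 0 < e -> exists N, forall m n,
       (N <= m)%N -> (N <= n)%N -> abs (u m - u n) < e) ->
    exists l, tends_to abs u l.

(* [(F, abs)] is the completion of the rationals for the p-adic absolute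
   value; multiplicativity makes it enough to prescribe [abs] on the positive
   integers. *)
Definition is_padic_field (R : realType) (p : nat) (F : fieldType)
    (abs : F -> R) :=
  [/\ absolute_value abs,
      forall m : nat, (0 < m)%N -> abs m%:R = p%:R ^- logn p m,
      forall (x : F) (e : R), 0 < e -> exists r : rat, abs (x - ratr r) < e
    & abs_complete abs].

Section Extension.

Context {R : realType} {Qp : fieldType} {K : fieldExtType Qp}.
Context {C : closedFieldType}.
Variables (emb : {rmorphism K -> C}) (abs : C -> R).

Definition base_emb (a : Qp) : C := emb a%:A.

(* [C], with the embedding [emb] of the finite extension [K] of [Qp], is an
   algebraic closure of [Qp], [Qp] is the field of p-adic numbers, and [abs]
   extends the p-adic absolute value. *)
Definition padic_closure (p : nat) :=
  [/\ absolute_value abs,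
      is_padic_field p (fun a => abs (base_emb a))
    & forall x : C, algebraicOver base_emb x].

Definition absK (x : K) : R := abs (emb x).

Definition integersK : set K := [set x | absK x <= 1].

Definition maxidealK : set K := [set x | absK x < 1].

Definition generates_maxideal (pi : K) :=
  maxidealK = [set pi * y | y in integersK].

(* The residue field of [K] has dimension [f] over that of [Qp]: the classes
   of some [e_1, ..., e_f] in the ring of integers of [K] form a basis.
   The classes of two integral elements agree iff the absolute value of their
   difference is less than 1. *)
Definition has_residue_degree (f : nat) :=
  exists e : 'I_f -> K,
    [/\ forall i, integersK (e i),
        forall x, integersK x -> exists c : 'I_f -> Qp,
          (forall i, integersK (c i)%:A) /\
          maxidealK (x - \sum_i c i *: e i)
      & forall c : 'I_f -> Qp, (forall i, integersK (c i)%:A) ->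
          maxidealK (\sum_i c i *: e i) -> forall i, maxidealK (c i)%:A].

Definition is_subfield (L : set C) := GRing.divring_closed (mem L).

Definition adjoin (L S : set C) : set C := smallest is_subfield (L `|` S).

Definition roots_of_unity (m : nat) : set C := [set x | m.-unity_root x].

(* A series in [n] variables is given by its coefficients. *)
Definition fps (n : nat) := 'X_{1..n} -> K.

Definition fps_trunc n (d : nat) (g : fps n) : {mpoly K[n]} :=
  \sum_(m : 'X_{1..n < d.+1}) g m *: 'X_[m].

Definition fps_var n (i : 'I_n) : fps n := fun m => (m == U_(i)%MM)%:R.

Definition fps_coef (g : fps 1) (i : nat) : K := g [multinom i | _ < 1].

(* [g(s_1, ..., s_k)], for [s_i] without constant term: the coefficients of
   total degree [d] only depend on the terms of degree at most [d] of [g] and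
   of the [s_i]. *)
Definition fps_subst k n (g : fps k) (s : k.-tuple (fps n)) : fps n :=
  fun m => (fps_trunc (mdeg m) g
              \mPo [tuple fps_trunc (mdeg m) (tnth s i) | i < k])@_m.

Definition fps_integral n (g : fps n) := forall m, integersK (g m).

Definition formal_group_law (F : fps 2) :=
  let X : fps 3 := fps_var 0 in
  let Y : fps 3 := fps_var 1 in
  let Z : fps 3 := fps_var 2%:R in
  [/\ fps_integral F,
      [/\ F 0%MM = 0, F U_(0%R)%MM = 1 & F U_(1%R)%MM = 1],
      fps_subst F [tuple fps_subst F [tuple X; Y]; Z]
        =1 fps_subst F [tuple X; fps_subst F [tuple Y; Z]]
    & fps_subst F [tuple fps_var 1; fps_var 0] =1 F].

Definition formal_endomorphism (F : fps 2) (g : fps 1) :=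
  [/\ fps_integral g,
      fps_coef g 0 = 0
    & fps_subst g [tuple F]
        =1 fps_subst F [tuple fps_subst g [tuple fps_var (0 : 'I_2)];
                              fps_subst g [tuple fps_var (1 : 'I_2)]]].

Definition integers_adjoin (pi : K) : set K :=
  [set a | a \in <<1; pi>>%VS /\ integersK a].

(* [br a] stands for the series [a](X); only its values on the ring of
   integers of [Qp(pi)] matter.  In the endomorphism ring of [F] the sum of
   [g] and [g'] is [F(g, g')], the product is composition, and the unit is
   the series [X]. *)
Definition formal_module (F : fps 2) (pi : K) (br : K -> fps 1) :=
  let A := integers_adjoin pi in
  [/\ forall a, A a ->
        formal_endomorphism F (br a) /\ fps_coef (br a) 1 = a,
      br 1 =1 fps_var 0,
      forall a b, A a -> A b ->
        br (a + b) =1 fps_subst F [tuple br a; br b]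
    & forall a b, A a -> A b -> br (a * b) =1 fps_subst (br a) [tuple br b]].

Definition unramified_law (pi : K) (F : fps 2) (br : K -> fps 1) :=
  formal_group_law F /\ formal_module F pi br.

(* [g] is the series [pi](X). *)
Definition has_height (p : nat) (g : fps 1) (h : nat) :=
  [/\ (2 <= p ^ h)%N,
      absK (fps_coef g (p ^ h)) = 1
    & forall i, (2 <= i < p ^ h)%N -> absK (fps_coef g i) <> 1].

(* The zeros in the open unit disc of [C], where the series converges. *)
Definition torsion (g : fps 1) : set C :=
  [set x | abs x < 1 /\
           tends_to abs
             (fun N => \sum_(i < N) emb (fps_coef g i) * x ^+ i) 0].

End Extension.

Arguments fps {Qp} K n.

(* Main.v *)
Require Import Defs.
From HB Require Import structures.
From mathcomp Require Import all_boot all_order all_algebra all_field.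
From mathcomp Require Import ring lra zify.
From mathcomp Require Import boolp classical_sets reals topology normedtype.
From mathcomp Require Import sequences.

Set Implicit Arguments.
Unset Strict Implicit.
Unset Printing Implicit Defensive.

Import Order.TTheory GRing.Theory Num.Theory.
Import numFieldNormedType.Exports.

Local Open Scope classical_set_scope.
Local Open Scope ring_scope.

(** Write [a_i] for the coefficients of [[pi](X)] and [q = p ^ h].  Then
   [a_0 = 0], [a_1 = pi], the [a_i] with [i < q] are divisible by [pi] and
   [a_q] is a unit: dividing by [X] gives an Eisenstein series, whose
   zeros generate a totally and tamely ramified extension of degree [q - 1].
   Such an extension is generated by a [(q - 1)]-th root.

   Choose [w] with [a_q * w ^ (q - 1) = - pi].  In the variable [t = X / w] the
   series becomes, up to the scalar [pi * w], [t - t ^ q] plus an integral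
   series divisible by [w].  Its derivative is close to 1, because [q] is small,
   so Newton's method lifts each root of unity of order dividing [q - 1] to one
   root, inside any complete field that contains [w] and this root of unity
   ([zero_near_root_of_unity]); conversely a nonzero torsion point divided by
   [w] is close to such a root of unity, hence is one of these lifts
   ([zero_approx], [zero_in_field]).  So the torsion lies in [K1(w)].  In the
   other direction, let [x] be a nonzero torsion point and [t = x / w]; then
   [t ^ (q - 1)] lies in [K1(x)] and is close to 1, and a number close to 1 has
   a [(q - 1)]-th root in any complete field that contains it
   ([one_unit_root]).  Hence [t] and [w] lie in [K1(x)]
   ([uniformizer_in_field]), and [K1(F[pi]) = K1(w)].

   It remains to see that [K1(w)] is the same field for all the laws.  The
   numbers [- pi_i / a_(i,q)] differ by units of [K].  Such a unit [u] has a
   [(q - 1)]-th root in [K1] ([unit_root]): if [v ^ (q - 1) = u], then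
   [v ^ ((q - 1) * (p ^ f - 1))] is close to 1 by Fermat's theorem in the
   residue field ([unit_fermat]), so [v] is close to a root of unity of [K1],
   and the correction is again a root of a number close to 1.

   The algebraic closure is not complete; limits are taken in [K1] with one
   element adjoined, which is complete because a finite span over a complete
   field is ([lspan_complete], [adjoin1_complete]). *)

(** * Ultrametric absolute values *)

Section Ultrametric.

Context {R : realType} {F : fieldType} {abs : F -> R}.
Hypothesis Habs : absolute_value abs.

Lemma abs_ge0 x : 0 <= abs x. Proof. by case: Habs. Qed.

Lemma abs_eq0 x : (abs x == 0) = (x == 0).
Proof. by case: Habs => _ H _ _; apply/eqP/eqP => /H. Qed.

Lemma abs0 : abs 0 = 0. Proof. by apply/eqP; rewrite abs_eq0. Qed.

Lemma abs_gt0 x : (0 < abs x) = (x != 0).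
Proof. by rewrite lt0r abs_eq0 abs_ge0 andbT. Qed.

Lemma absM x y : abs (x * y) = abs x * abs y. Proof. by case: Habs. Qed.

Lemma abs1 : abs 1 = 1.
Proof.
have n0 : abs 1 != 0 by rewrite abs_eq0 oner_eq0.
by apply: (mulfI n0); rewrite -absM !mulr1.
Qed.

Lemma absX x n : abs (x ^+ n) = abs x ^+ n.
Proof. by elim: n => [|n IH]; rewrite ?expr0 ?abs1 // !exprS absM IH. Qed.

Lemma absN1 : abs (-1) = 1.
Proof.
apply/eqP; rewrite -(@pexpr_eq1 _ _ 2) ?abs_ge0 //.
by rewrite -absX sqrrN expr1n abs1.
Qed.

Lemma absN x : abs (- x) = abs x.
Proof. by rewrite -mulN1r absM absN1 mul1r. Qed.

Lemma absV x : abs x^-1 = (abs x)^-1.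
Proof.
have [->|x0] := eqVneq x 0; first by rewrite invr0 abs0 invr0.
apply: (@mulfI _ (abs x)); first by rewrite abs_eq0.
by rewrite -absM !divff ?abs1 // abs_eq0.
Qed.

Lemma absB x y : abs (x - y) = abs (y - x).
Proof. by rewrite -absN opprB. Qed.

Lemma abs_leD B x y : abs x <= B -> abs y <= B -> abs (x + y) <= B.
Proof.
by case: Habs => _ _ _ H hx hy; apply: le_trans (H x y) _; rewrite ge_max hx.
Qed.

Lemma abs_ltD B x y : abs x < B -> abs y < B -> abs (x + y) < B.
Proof.
by case: Habs => _ _ _ H hx hy; apply: le_lt_trans (H x y) _; rewrite gt_max hx.
Qed.

Lemma abs_leB B x y : abs x <= B -> abs y <= B -> abs (x - y) <= B.
Proof. by move=> hx hy; apply: abs_leD; rewrite ?absN. Qed.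

Lemma abs_ltB B x y : abs x < B -> abs y < B -> abs (x - y) < B.
Proof. by move=> hx hy; apply: abs_ltD; rewrite ?absN. Qed.

Lemma abs_ltBB B x y z : abs (x - y) < B -> abs (y - z) < B -> abs (x - z) < B.
Proof. by move=> hx hy; have := abs_ltD hx hy; rewrite subrKA. Qed.

Lemma abs_leBB B x y z :
  abs (x - y) <= B -> abs (y - z) <= B -> abs (x - z) <= B.
Proof. by move=> hx hy; have := abs_leD hx hy; rewrite subrKA. Qed.

(** In an ultrametric triangle the longest side is attained twice. *)
Lemma abs_dominant x y : abs (x - y) < abs x -> abs x = abs y.
Proof.
move=> H; apply/eqP; rewrite eq_le; apply/andP; split; last first.
  by rewrite -[y](subKr x); apply: abs_leB => //; apply: ltW.
rewrite leNgt; apply/negP => H1; have := abs_ltD H H1.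
by rewrite subrK ltxx.
Qed.

Lemma abs_unit_near x y : abs x = 1 -> abs (x - y) < 1 -> abs y = 1.
Proof. by move=> x1 H; rewrite -(@abs_dominant x) x1. Qed.

Lemma abs_sum_le (I : Type) (r : seq I) (P : pred I) (f : I -> F) B :
  0 <= B -> (forall i, P i -> abs (f i) <= B) ->
  abs (\sum_(i <- r | P i) f i) <= B.
Proof.
move=> B0 H; elim/big_ind: _ => //; first by rewrite abs0.
by move=> x y; apply: abs_leD.
Qed.

Lemma abs_prod (I : Type) (r : seq I) (P : pred I) (f : I -> F) :
  abs (\prod_(i <- r | P i) f i) = \prod_(i <- r | P i) abs (f i).
Proof. exact: (big_morph abs absM abs1). Qed.

Lemma abs_nat_le1 n : abs n%:R <= 1.
Proof.
elim: n => [|n IH]; first by rewrite abs0.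
by rewrite -addn1 natrD; apply: abs_leD; rewrite ?abs1.
Qed.

Lemma abs_int_le1 (z : int) : abs z%:~R <= 1.
Proof. by case: z => n; rewrite ?NegzE ?mulrNz ?absN; apply: abs_nat_le1. Qed.

Lemma tends_toP u l : tends_to abs u l <->
  forall e : R, 0 < e -> exists N, forall n, (N <= n)%N -> abs (u n - l) < e.
Proof.
rewrite /tends_to; split=> [/cvgr0Pnorm_lt H e /H [N _ HN]|H].
  by exists N => n /HN /=; rewrite ger0_norm ?abs_ge0.
apply/cvgr0Pnorm_lt => e /H [N HN]; exists N => // n /= /HN.
by rewrite ger0_norm ?abs_ge0.
Qed.

Definition cauchy_seq (u : nat -> F) := forall e : R, 0 < e ->
  exists N, forall m n, (N <= m)%N -> (N <= n)%N -> abs (u m - u n) < e.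

Lemma tends_to_cauchy u l : tends_to abs u l -> cauchy_seq u.
Proof.
move/tends_toP => H e /H [N HN]; exists N => m n /HN hm /HN hn.
by apply: abs_ltBB hm _; rewrite absB.
Qed.

Lemma tends_to_unique u l l' : tends_to abs u l -> tends_to abs u l' -> l = l'.
Proof.
move=> /tends_toP H /tends_toP H'; apply/eqP; rewrite -subr_eq0 -abs_eq0.
rewrite eq_le abs_ge0 andbT leNgt; apply/negP => e0.
have [N HN] := H _ e0; have [N' HN'] := H' _ e0.
have := @abs_ltBB (abs (l - l')) l (u (maxn N N')) l'.
rewrite ltxx absB HN ?leq_maxl // HN' ?leq_maxr //.
by move=> /(_ isT isT).
Qed.

Lemma geometric_small (d : R) : 0 <= d < 1 ->
  forall e : R, 0 < e -> exists N, forall n, (N <= n)%N -> d ^+ n < e.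
Proof.
move=> /andP[d0 d1] e e0.
have /cvgr0Pnorm_lt/(_ e e0) [N _ HN] : (d ^+ n @[n --> \oo] --> (0 : R)).
  by apply: cvg_expr; rewrite ger0_norm.
by exists N => n /HN /=; rewrite ger0_norm // exprn_ge0.
Qed.

End Ultrametric.

(** * Subfields, spans and adjunction *)

Section Subfields.

Context {F : closedFieldType}.
Implicit Types (L W S : set F).

Lemma is_subfieldP L : is_subfield L <->
  [/\ L 1, forall x y, L x -> L y -> L (x - y)
    & forall x y, L x -> L y -> L (x / y)].
Proof.
split=> [[h1 hB hV]|[h1 hB hV]]; split.
- by move: h1; rewrite inE.
- by move=> x y hx hy; have := hB x y; rewrite !inE; apply.
- by move=> x y hx hy; have := hV x y; rewrite !inE; apply.
- by rewrite inE.
- by move=> x y; rewrite !inE; apply: hB.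
- by move=> x y; rewrite !inE; apply: hV.
Qed.

Section Closure.

Variable L : set F.
Hypothesis HL : is_subfield L.

Lemma subfield1 : L 1. Proof. by case/is_subfieldP: HL. Qed.

Lemma subfieldB x y : L x -> L y -> L (x - y).
Proof. by case/is_subfieldP: HL => _ H _; apply: H. Qed.

Lemma subfield_div x y : L x -> L y -> L (x / y).
Proof. by case/is_subfieldP: HL => _ _; apply. Qed.

Lemma subfield0 : L 0.
Proof. by rewrite -(subrr 1); apply: subfieldB; apply: subfield1. Qed.

Lemma subfieldN x : L x -> L (- x).
Proof. by move=> hx; rewrite -sub0r; apply: subfieldB => //; apply: subfield0. Qed.

Lemma subfieldD x y : L x -> L y -> L (x + y).
Proof. by move=> hx hy; rewrite -[y]opprK; apply: subfieldB => //; apply: subfieldN. Qed.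

Lemma subfieldV x : L x -> L x^-1.
Proof. by move=> hx; rewrite -div1r; apply: subfield_div => //; apply: subfield1. Qed.

Lemma subfieldM x y : L x -> L y -> L (x * y).
Proof. by move=> hx hy; rewrite -[y]invrK; apply: subfield_div => //; apply: subfieldV. Qed.

Lemma subfieldX x n : L x -> L (x ^+ n).
Proof.
move=> hx; elim: n => [|n IH]; first exact: subfield1.
by rewrite exprS; apply: subfieldM.
Qed.

Lemma subfield_sum (I : Type) (r : seq I) (P : pred I) (f : I -> F) :
  (forall i, P i -> L (f i)) -> L (\sum_(i <- r | P i) f i).
Proof. by move=> H; elim/big_ind: _ => //; [apply: subfield0|apply: subfieldD]. Qed.

End Closure.

Lemma sub_adjoinl L S : L `<=` adjoin L S.
Proof. by move=> x Lx; apply: sub_gen_smallest; left. Qed.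

Lemma sub_adjoinr L S : S `<=` adjoin L S.
Proof. by move=> x Sx; apply: sub_gen_smallest; right. Qed.

Lemma adjoin_sub L S W :
  is_subfield W -> L `<=` W -> S `<=` W -> adjoin L S `<=` W.
Proof. by move=> hW h1 h2; apply: smallest_sub => // x []; [apply: h1|apply: h2]. Qed.

Lemma adjoin_subfield L S : is_subfield (adjoin L S).
Proof.
apply/is_subfieldP; split.
- by move=> W [hW _]; apply: subfield1.
- by move=> x y hx hy W hW; apply: (subfieldB hW.1); [apply: hx|apply: hy].
- by move=> x y hx hy W hW; apply: (subfield_div hW.1); [apply: hx|apply: hy].
Qed.

Lemma adjoin_cat L S1 S2 :
  adjoin (adjoin L S1) S2 = adjoin L (S1 `|` S2).
Proof.
apply/seteqP; split; apply: adjoin_sub (adjoin_subfield _ _) _ _.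
- apply: adjoin_sub (adjoin_subfield _ _) _ _ => [|x hx]; first exact: sub_adjoinl.
  by apply: sub_adjoinr; left.
- by move=> x hx; apply: sub_adjoinr; right.
- by move=> x hx; do 2 apply: sub_adjoinl.
- move=> x [hx|hx]; last exact: sub_adjoinr.
  by apply: sub_adjoinl; apply: sub_adjoinr.
Qed.

Definition submodule L W :=
  [/\ W 0, forall x y, W x -> W y -> W (x + y)
    & forall c x, L c -> W x -> W (c * x)].

Lemma subfield_submodule L W : is_subfield W -> L `<=` W -> submodule L W.
Proof.
move=> HW LW; split; first exact: subfield0.
- by move=> x y; apply: subfieldD.
- by move=> c x /LW; apply: subfieldM.
Qed.

Fixpoint lspan L (vs : seq F) : set F :=
  if vs is v :: vs' then
    [set x | exists c y, [/\ L c, lspan L vs' y & x = c * v + y]]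
  else [set 0].

Lemma lspan_sub L vs W :
  submodule L W -> (forall v, v \in vs -> W v) -> lspan L vs `<=` W.
Proof.
move=> [W0 WD WZ]; elim: vs => [|v vs IH] Wvs x /=; first by move=> ->.
move=> [c [y [Lc hy ->]]]; apply: (WD).
  by apply: (WZ) => //; apply: Wvs; rewrite mem_head.
by apply: IH hy => u hu; apply: Wvs; rewrite inE hu orbT.
Qed.

Lemma lspan_submodule L vs : is_subfield L -> submodule L (lspan L vs).
Proof.
move=> HL; elim: vs => [|v vs [W0 WD WZ]] /=.
  split=> //= [x y -> ->|c x _ ->]; first by rewrite addr0.
  by rewrite mulr0.
split.
- by exists 0, 0; rewrite mul0r addr0; split=> //; apply: subfield0.
- move=> _ _ [c [y [Lc hy ->]]] [c' [y' [Lc' hy' ->]]].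
  exists (c + c'), (y + y'); split; [exact: subfieldD|exact: WD|by rewrite mulrDl addrACA].
- move=> a _ La [c [y [Lc hy ->]]].
  exists (a * c), (a * y); split; [exact: subfieldM|exact: WZ|by rewrite mulrDr mulrA].
Qed.

Lemma mem_lspan L vs v : is_subfield L -> v \in vs -> lspan L vs v.
Proof.
move=> HL; elim: vs => [//|u vs IH]; rewrite inE => /orP[/eqP<-|/IH hv] /=.
  exists 1, 0; rewrite mul1r addr0; split=> //; first exact: subfield1.
  by case: (lspan_submodule vs HL).
by exists 0, v; rewrite mul0r add0r; split=> //; apply: subfield0.
Qed.

(** After division by a power of ['X] the polynomial [P] has a nonzero constant
   term, and [P.[y] = 0] then writes [y^-1] as a polynomial in [y]. *)
Lemma algebraic_subring_inv L W (P : {poly F}) y :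
  is_subfield L -> L `<=` W -> submodule L W ->
  (forall x x', W x -> W x' -> W (x * x')) ->
  (forall i, L P`_i) -> P != 0 -> root P y -> W y -> W y^-1.
Proof.
move=> HL LW [W0 WD WZ] WM LP.
have [->|y0] := eqVneq y 0; first by rewrite invr0.
have [n] := ubnP (size P); elim: n P LP => // n IH P LP sP P0 Py Wy.
elim/poly_ind: P => [|Q c _] in LP sP P0 Py *; first by rewrite eqxx in P0.
have LQ i : L Q`_i.
  by have := LP i.+1; rewrite coefD coefMX coefC /= addr0.
have Lc : L c by have := LP 0%N; rewrite coefD coefMX coefC /= add0r.
move: Py; rewrite rootE hornerD hornerMX hornerC.
have [c0|c0] := eqVneq c 0.
  rewrite c0 addr0 mulf_eq0 (negPf y0) orbF => Qy.
  move: P0 sP; rewrite c0 addr0 => P0; have Q0 : Q != 0.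
    by apply: contraNneq P0 => ->; rewrite mul0r.
  by rewrite size_mulX // ltnS => sQ; apply: (IH Q).
rewrite addr_eq0 => /eqP E.
have -> : y^-1 = - c^-1 * Q.[y].
  apply: (mulIf y0); rewrite mulVf // -mulrA E mulrN mulNr opprK mulVf //.
apply: (WZ); first by apply: subfieldN => //; apply: subfieldV.
rewrite horner_coef; apply: (big_ind W) => // i _; apply: (WZ) => //.
elim: (i : nat) => [|k Wk]; first by apply: LW; apply: subfield1.
by rewrite exprS; apply: (WM).
Qed.

(** Adjoining an element integral over [L] gives the span of its powers: this
   span is stable under multiplication because the next power already lies
   in it, hence it is a field as its elements are algebraic over [Q]. *)
Lemma adjoin_integral L Q z d :
  is_subfield L -> is_subfield Q -> Q `<=` L ->
  (forall x : F, exists P : {poly F},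
     [/\ forall i, Q P`_i, P != 0 & root P x]) ->
  lspan L [seq z ^+ i | i <- iota 0 d] (z ^+ d) ->
  adjoin L [set z] = lspan L [seq z ^+ i | i <- iota 0 d].
Proof.
move=> HL HQ QL alg zd; set W := lspan _ _.
have [W0 WD WZ] : submodule L W by apply: lspan_submodule.
have Wz x : W x -> W (x * z).
  apply: (@lspan_sub L _ [set x | W (x * z)]) => [|v].
    split=> /= [|u v Wu Wv|c u Lc Wu]; first by rewrite mul0r.
      by rewrite mulrDl; apply: (WD).
    by rewrite -mulrA; apply: (WZ).
  case/mapP => i; rewrite mem_iota add0n => /= id ->; rewrite -exprSr.
  move: id; rewrite leq_eqVlt => /orP[/eqP->//|id].
  by apply: mem_lspan => //; apply: map_f; rewrite mem_iota.
have W1 : W 1.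
  case: d @W W0 WD WZ Wz zd => [|d] W W0 WD WZ Wz zd; first by move: zd; rewrite /= expr0.
  by apply: mem_lspan => //; apply/mapP; exists 0%N.
have WX x i : W x -> W (x * z ^+ i).
  move=> Wx; elim: i => [|i IH]; first by rewrite expr0 mulr1.
  by rewrite exprSr mulrA; apply: (Wz).
have WM x y : W x -> W y -> W (x * y).
  move=> Wx; apply: (@lspan_sub L _ [set y | W (x * y)]) => [|v].
    split=> /= [|u v Wu Wv|c u Lc Wu]; first by rewrite mulr0.
      by rewrite mulrDr; apply: (WD).
    by rewrite mulrCA; apply: (WZ).
  by case/mapP => i _ -> /=; apply: (WX).
have LW : L `<=` W by move=> c Lc; rewrite -[c]mulr1; apply: (WZ).
have HW : is_subfield W.
  apply/is_subfieldP; split=> // x y Wx Wy.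
    rewrite -mulN1r; apply: (WD) => //; apply: (WZ) => //.
    by apply: subfieldN => //; apply: subfield1.
  apply: (WM) => //; have [P [QP P0 Py]] := alg y.
  apply: (algebraic_subring_inv HQ _ _ WM QP P0 Py Wy).
    by move=> u /QL/LW.
  by split=> // c u /QL Lc; apply: (WZ).
apply/seteqP; split.
  by apply: adjoin_sub => // _ ->; rewrite -[z]mul1r; apply: (Wz).
apply: lspan_sub.
  apply: subfield_submodule; [exact: adjoin_subfield|exact: sub_adjoinl].
move=> _ /mapP[i _ ->]; apply: (subfieldX (adjoin_subfield _ _)).
exact: sub_adjoinr.
Qed.

End Subfields.

(** * Completeness of finite extensions *)

Section Completeness.

Context {R : realType} {F : closedFieldType} {abs : F -> R}.
Hypothesis Habs : absolute_value abs.
Implicit Types (L W : set F).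

Let abs_ge0 := abs_ge0 Habs.
Let absM := absM Habs.
Let abs_ltD := abs_ltD Habs.

Definition complete_in L := forall u : nat -> F,
  (forall n, L (u n)) -> cauchy_seq (abs := abs) u ->
  exists2 l, L l & tends_to abs u l.

(** Otherwise elements of [W] would converge to [v], and [v] would be in [W]. *)
Lemma complete_distance L W v :
  is_subfield L -> submodule L W -> complete_in W -> ~ W v ->
  exists2 e : R, 0 < e & forall y, W y -> e <= abs (v - y).
Proof.
move=> HL [W0 WD WZ] cW Wv; apply: contrapT => Hn.
have half : 0 <= (2^-1 : R) < 1 by lra.
have /choice[y Hy] n : exists y, W y /\ abs (v - y) < 2^-1 ^+ n.
  apply: contrapT => Hy; apply: Hn; exists (2^-1 ^+ n).
    by rewrite exprn_gt0 ?invr_gt0.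
  move=> y Wy; rewrite leNgt; apply/negP => h; apply: Hy.
  by exists y.
have Hv : tends_to abs y v.
  apply/(tends_toP Habs) => e e0; have [N HN] := geometric_small half e0.
  exists N => n /HN; apply: lt_trans; rewrite (absB Habs).
  by case: (Hy n).
have [l Wl Hl] := cW y (fun n => (Hy n).1) (tends_to_cauchy Habs Hv).
by apply: Wv; rewrite (tends_to_unique Habs Hv Hl).
Qed.

(** Let [v] be outside [W]; its distance to [W] is bounded below.  So
   [abs c] is at most a constant multiple of [abs (c * v + y)], and the
   coordinates [c] and [y] of a Cauchy sequence are Cauchy. *)
Lemma lspan_complete L vs :
  is_subfield L -> complete_in L -> complete_in (lspan L vs).
Proof.
move=> HL cL; elim: vs => [|v vs cW] /=.
  move=> u u0 _; exists 0 => //; apply/(tends_toP Habs) => e e0.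
  by exists 0%N => n _; rewrite u0 subr0 (abs0 Habs).
have [W0 WD WZ] := lspan_submodule vs HL; set W := lspan L vs in cW W0 WD WZ *.
have L0 := subfield0 HL.
have [Wv|nWv] := pselect (W v).
  move=> u hu /cW[n|l Wl ul].
    by have [c [y [Lc Wy ->]]] := hu n; apply: (WD) => //; apply: (WZ).
  by exists l => //; exists 0, l; rewrite mul0r add0r.
have [d d0 Hd] := complete_distance HL (And3 W0 WD WZ) cW nWv.
have bound c y : L c -> W y -> abs c * d <= abs (c * v + y).
  move=> Lc Wy; have [->|c0] := eqVneq c 0.
    by rewrite (abs0 Habs) !mul0r.
  have -> : c * v + y = c * (v - - c^-1 * y).
    by rewrite mulrBr !mulNr mulrN opprK mulVKf.
  rewrite absM ler_wpM2l //; apply: Hd; apply: (WZ) => //.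
  by apply: subfieldN => //; apply: subfieldV.
move=> u /choice[c] /choice[y] H Hu.
have Lc n : L (c n) by case: (H n).
have Wy n : W (y n) by case: (H n).
have uE n : u n = c n * v + y n by case: (H n).
have diff m n : abs (c m - c n) * d <= abs (u m - u n).
  have -> : u m - u n = (c m - c n) * v + (y m - y n) by rewrite !uE; ring.
  apply: bound; first exact: subfieldB.
  apply: (WD) => //; rewrite -mulN1r; apply: (WZ) => //.
  by apply: subfieldN => //; apply: subfield1.
have c_cauchy : cauchy_seq (abs := abs) c.
  move=> e e0; have [N HN] := Hu (e * d) (mulr_gt0 e0 d0).
  exists N => m n hm hn; rewrite -(ltr_pM2r d0).
  by apply: le_lt_trans (diff m n) _; apply: HN.
have [lc Llc Hlc] := cL _ Lc c_cauchy.
have small e : 0 < e -> exists2 e' : R, 0 < e' & forall x, abs x < e' ->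
    abs (x * v) < e.
  move=> e0; exists (e / (abs v + 1)); first by rewrite divr_gt0 // ltr_wpDl.
  move=> x; rewrite ltr_pdivlMr ?ltr_wpDl // absM; apply: le_lt_trans.
  by rewrite ler_wpM2l // lerDl.
have y_cauchy : cauchy_seq (abs := abs) y.
  move=> e e0; have [e' e'0 He'] := small e e0.
  have [N HN] := Hu e e0; have [N' HN'] := c_cauchy e' e'0.
  exists (maxn N N') => m n; rewrite !geq_max => /andP[m1 m2] /andP[n1 n2].
  have -> : y m - y n = (u m - u n) - (c m - c n) * v by rewrite !uE; ring.
  by apply: (abs_ltB Habs); [apply: HN|apply/He'/HN'].
have [ly Wly Hly] := cW _ Wy y_cauchy.
exists (lc * v + ly); first by exists lc, ly.
apply/(tends_toP Habs) => e e0; have [e' e'0 He'] := small e e0.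
have [N HN] := (tends_toP Habs _ _).1 Hly e e0.
have [N' HN'] := (tends_toP Habs _ _).1 Hlc e' e'0.
exists (maxn N N') => n; rewrite geq_max => /andP[h1 h2].
have -> : u n - (lc * v + ly) = (c n - lc) * v + (y n - ly) by rewrite uE; ring.
by apply: abs_ltD; [apply/He'/HN'|apply: HN].
Qed.

(** A nonzero polynomial over [Q] cancelling [z] writes some power of [z] on
   the lower ones. *)
Lemma adjoin1_complete L Q z :
  is_subfield L -> is_subfield Q -> Q `<=` L ->
  (forall x : F, exists P : {poly F},
     [/\ forall i, Q P`_i, P != 0 & root P x]) ->
  complete_in L -> complete_in (adjoin L [set z]).
Proof.
move=> HL HQ QL alg cL; have [P [QP P0 Pz]] := alg z.
rewrite (@adjoin_integral _ L Q z (size P).-1) //; first exact: lspan_complete.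
have [W0 WD WZ] := lspan_submodule [seq z ^+ i | i <- iota 0 (size P).-1] HL.
set W := lspan _ _ in W0 WD WZ *.
have sP : size P = (size P).-1.+1 by rewrite prednK // size_poly_gt0.
move: Pz; rewrite rootE horner_coef sP big_ord_recr /= addrC addr_eq0 => /eqP E.
have c0 : P`_(size P).-1 != 0 by rewrite -lead_coefE lead_coef_eq0.
have -> : z ^+ (size P).-1 = - (P`_(size P).-1)^-1 * \sum_(i < (size P).-1) P`_i * z ^+ i.
  by apply: (mulfI c0); rewrite E mulrA mulrN divff // mulN1r.
apply: (WZ); first by apply: subfieldN => //; apply: subfieldV => //; apply: QL.
apply: (big_ind W) => // i _; apply: (WZ); first exact: QL.
by apply: (mem_lspan HL); apply/mapP; exists (i : nat); rewrite ?mem_iota /=.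
Qed.

Lemma adjoin_complete L Q (s : seq F) :
  is_subfield L -> is_subfield Q -> Q `<=` L ->
  (forall x : F, exists P : {poly F},
     [/\ forall i, Q P`_i, P != 0 & root P x]) ->
  complete_in L -> complete_in (adjoin L [set x | x \in s]).
Proof.
move=> + HQ + alg; elim: s L => [|z s IH] L HL QL cL.
  suff -> : adjoin L [set x | x \in [::]] = L by [].
  by apply/seteqP; split; [apply: adjoin_sub|apply: sub_adjoinl].
have -> : [set x | x \in z :: s] = [set z] `|` [set x | x \in s].
  apply/seteqP; split=> x /=; first by rewrite inE => /orP[/eqP|]; [left|right].
  by case=> [->|h]; rewrite inE ?eqxx // h orbT.
rewrite -adjoin_cat; apply: IH; first exact: adjoin_subfield.
  by move=> x /QL; apply: sub_adjoinl.
exact: (@adjoin1_complete L Q).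
Qed.

End Completeness.

(** * Newton's method for power series *)

Section Hensel.

Context {R : realType} {F : closedFieldType} {abs : F -> R}.
Hypothesis Habs : absolute_value abs.

Let abs_ge0 := abs_ge0 Habs.
Let absM := absM Habs.
Let absX := absX Habs.

(** The product of the distances from [v] to the roots of [X^m - 1] is
   [abs (v ^+ m - 1)], so one of the distances is small. *)
Lemma near_root_of_unity m v : (0 < m)%N -> abs (v ^+ m - 1) < 1 ->
  exists2 z, z ^+ m = 1 & abs (v - z) < 1.
Proof.
move=> m0 H; have [r rE] := closed_field_poly_normal ('X^m - 1 : {poly F}).
rewrite (monicP (monic_Xn_sub_1 F m0)) scale1r in rE.
have vE x : x ^+ m - 1 = \prod_(z <- r) (x - z).
  have := congr1 (fun P => P.[x]) rE; rewrite hornerD hornerN hornerXn hornerC.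
  by rewrite horner_prod => ->; apply: eq_bigr => z _; rewrite hornerXsubC.
apply: contrapT => Hn; move: H; apply/negP; rewrite -leNgt vE (abs_prod Habs).
rewrite big_seq; elim/big_ind: _ => // [x y|z zr]; first exact: mulr_ege1.
rewrite leNgt; apply/negP => hz; apply: Hn; exists z => //.
by apply/eqP; rewrite -subr_eq0 vE (big_rem z) //= subrr mul0r.
Qed.

Definition partial_sum (c : nat -> F) (t : F) N := \sum_(i < N) c i * t ^+ i.

Lemma partial_sum_split c t N q : (1 < N)%N -> (q < N)%N -> q != 1%N ->
  partial_sum c t N = c 1%N * t + c q * t ^+ q
    + \sum_(i < N | (i != 1 :> nat) && (i != q :> nat)) c i * t ^+ i.
Proof.
move=> N1 Nq q1; rewrite /partial_sum (bigD1 (Ordinal N1)) //= expr1.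
by rewrite (bigD1 (Ordinal Nq)) //= addrA.
Qed.

Lemma tends_to0_scale k u :
  tends_to abs u 0 -> tends_to abs (fun n => k * u n) 0.
Proof.
have [->|k0] := eqVneq k 0.
  move=> _; apply/(tends_toP Habs) => e e0; exists 0%N => n _.
  by rewrite mul0r subr0 (abs0 Habs).
have k'0 : 0 < abs k by rewrite (abs_gt0 Habs).
move=> /(tends_toP Habs) H; apply/(tends_toP Habs) => e e0.
have [N HN] := H (e / abs k) (divr_gt0 e0 k'0).
exists N => n /HN; rewrite !subr0 absM ltr_pdivlMr //.
by rewrite mulrC.
Qed.

Lemma sub_exp_le s t i : abs s <= 1 -> abs t <= 1 ->
  abs (s ^+ i - t ^+ i) <= abs (s - t).
Proof.
move=> s1 t1; rewrite subrXX absM ler_piMr //; apply: (abs_sum_le Habs) => // j _.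
by rewrite absM !absX mulr_ile1 ?exprn_ge0 ?exprn_ile1.
Qed.

(** The power map is a contraction on small discs when its degree is small:
   the quotient of differences is congruent to [q%:R * t ^+ q.-1]. *)
Lemma sub_exp_contract (d : R) q s t : abs s <= 1 -> abs t <= 1 ->
  abs (s - t) <= d -> abs q%:R <= d ->
  abs (s ^+ q - t ^+ q) <= d * abs (s - t).
Proof.
move=> s1 t1 st qd; have d0 : 0 <= d := le_trans (abs_ge0 _) qd.
rewrite subrXX absM mulrC ler_wpM2r //.
rewrite (eq_bigr (fun i : 'I_q => (s ^+ (q.-1 - i) - t ^+ (q.-1 - i)) * t ^+ i
                               + t ^+ q.-1)); last first.
  move=> i _; rewrite mulrBl -exprD subnK ?subrK //.
  by rewrite -ltnS prednK ?ltn_ord // (leq_ltn_trans _ (ltn_ord i)).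
rewrite big_split /= sumr_const card_ord -mulr_natr; apply: (abs_leD Habs).
  apply: (abs_sum_le Habs) => // i _; rewrite absM absX.
  rewrite -[d]mulr1 ler_pM ?exprn_ge0 ?exprn_ile1 //.
  by apply: le_trans st; apply: sub_exp_le.
by rewrite absM absX -[d]mul1r ler_pM ?exprn_ge0 ?exprn_ile1.
Qed.

(** For a series [G(t) = t + c_q t^q + ...] whose other coefficients are
   small and with [q] small, the derivative is close to 1; so [t - G(t)]
   contracts small discs. *)
Lemma newton_contract (d : R) q c N s t :
  abs q%:R <= d -> c 1%N = 1 -> abs (c q) <= 1 ->
  (forall i, i != 1%N -> i != q -> abs (c i) <= d) ->
  (1 < N)%N -> abs s <= 1 -> abs t <= 1 -> abs (s - t) <= d ->
  abs ((s - partial_sum c s N) - (t - partial_sum c t N)) <= d * abs (s - t).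
Proof.
move=> qd c1 cq cd N1 s1 t1 st; have d0 : 0 <= d := le_trans (abs_ge0 _) qd.
have SE u : u - partial_sum c u N = - \sum_(i < N | i != Ordinal N1) c i * u ^+ i.
  by rewrite /partial_sum (bigD1 (Ordinal N1)) //= c1 mul1r expr1; ring.
rewrite !SE opprK addrC -sumrB.
apply: (abs_sum_le Habs) => [|i i1]; first exact: mulr_ge0.
have {}i1 : (i : nat) != 1%N by [].
rewrite -mulrBr absM [abs (s - t)](absB Habs); have [iq|iq] := eqVneq (i : nat) q.
  rewrite iq -[leRHS]mul1r ler_pM //; apply: sub_exp_contract => //.
  by rewrite (absB Habs).
by rewrite ler_pM // ?cd // sub_exp_le.
Qed.

(** The difference of two roots equals its image under [t - G(t)], which
   contracts it. *)
Lemma series_root_unique (d : R) q c s t :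
  abs q%:R <= d -> d < 1 -> c 1%N = 1 -> abs (c q) <= 1 ->
  (forall i, i != 1%N -> i != q -> abs (c i) <= d) ->
  abs s <= 1 -> abs t <= 1 -> abs (s - t) <= d ->
  tends_to abs (partial_sum c s) 0 -> tends_to abs (partial_sum c t) 0 -> s = t.
Proof.
move=> qd d1 c1 cq cd s1 t1 st /(tends_toP Habs) Hs /(tends_toP Habs) Ht.
apply/eqP; rewrite -subr_eq0; apply: contraT => st0.
have e0 : 0 < abs (s - t) by rewrite (abs_gt0 Habs).
have [N HN] := Hs _ e0; have [N' HN'] := Ht _ e0.
pose M := maxn 2 (maxn N N').
have hs : abs (partial_sum c s M) < abs (s - t).
  by have := HN M; rewrite subr0; apply; rewrite !leq_max leqnn orbT.
have ht : abs (partial_sum c t M) < abs (s - t).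
  by have := HN' M; rewrite subr0; apply; rewrite !leq_max leqnn !orbT.
have M1 : (1 < M)%N by rewrite leq_max.
have H := newton_contract qd c1 cq cd M1 s1 t1 st.
have {}H : abs (s - partial_sum c s M - (t - partial_sum c t M)) < abs (s - t).
  by apply: le_lt_trans H _; rewrite gtr_pMl.
have := abs_ltD Habs H (abs_ltB Habs hs ht).
suff -> : s - partial_sum c s M - (t - partial_sum c t M) +
  (partial_sum c s M - partial_sum c t M) = s - t by rewrite ltxx.
by ring.
Qed.

(** The approximation of the root uses one more term of the series at each
   step, so that no value of the series is needed before the limit: step [n]
   changes the approximation by at most [d ^+ n.+1]. *)
Fixpoint newton_seq (c : nat -> F) q t0 n : F :=
  if n is n'.+1 then
    newton_seq c q t0 n' - partial_sum c (newton_seq c q t0 n') (n' + q + 2)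
  else t0.

Lemma series_root_exists (L : set F) (d : R) q c t0 :
  is_subfield L -> complete_in (abs := abs) L -> (forall i, L (c i)) -> L t0 ->
  abs q%:R <= d -> 0 < d < 1 -> c 1%N = 1 -> abs (c q) <= 1 ->
  (forall i, i != 1%N -> i != q -> abs (c i) <= d) ->
  (forall j, abs (c (q + 1 + j)%N) <= d ^+ j.+1) ->
  abs t0 <= 1 -> abs (partial_sum c t0 (q + 2)) <= d ->
  exists t, [/\ L t, abs (t - t0) <= d & tends_to abs (partial_sum c t) 0].
Proof.
move=> HL cL Lc Lt0 qd /andP[d0 d1] c1 cq cd ctail t01 St0.
have dX1 n : d ^+ n.+1 <= d by rewrite ler_iXnr // ltW.
set u := newton_seq c q t0.
have close1 x : abs (x - t0) <= d -> abs x <= 1.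
  move=> h; rewrite -[x](subrK t0); apply: (abs_leD Habs) => //.
  by apply: le_trans h _; apply: ltW.
have Hu n : [/\ L (u n), abs (u n - t0) <= d
              & abs (partial_sum c (u n) (n + q + 2)) <= d ^+ n.+1].
  elim: n => [|n [Lu ut0 Su]].
    by rewrite /u /= subrr (abs0 Habs) ltW ?expr1.
  have Sud := le_trans Su (dX1 n).
  have step : u n.+1 - u n = - partial_sum c (u n) (n + q + 2).
    by rewrite /u /=; ring.
  have ut1 : abs (u n.+1 - t0) <= d.
    by apply: (abs_leBB Habs) ut0; rewrite step (absN Habs).
  split=> //.
    rewrite /u /=; apply: subfieldB => //; apply: (subfield_sum HL) => i _.
    by apply: subfieldM => //; apply: subfieldX.
  rewrite 2!addSn /partial_sum big_ord_recr /= -/(partial_sum _ _ _).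
  apply: (abs_leD Habs); last first.
    rewrite absM absX; have -> : (n + q + 2 = q + 1 + n.+1)%N
      by rewrite addn2 addn1 addnS addSn addnC.
    rewrite -[leRHS]mulr1 ler_pM ?exprn_ge0 ?exprn_ile1 //; exact: close1.
  have N1 : (1 < n + q + 2)%N by rewrite addn2.
  have st : abs (u n.+1 - u n) <= d by rewrite step (absN Habs).
  have := newton_contract qd c1 cq cd N1 (close1 _ ut1) (close1 _ ut0) st.
  have -> : u n - partial_sum c (u n) (n + q + 2) = u n.+1 by [].
  rewrite addrAC subrr add0r (absN Habs) => H; apply: le_trans H _.
  by rewrite [leRHS]exprS ler_pM2l // step (absN Habs).
have dist n k : abs (u (n + k)%N - u n) <= d ^+ n.+1.
  elim: k => [|k IH]; first by rewrite addn0 subrr (abs0 Habs) exprn_ge0 // ltW.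
  apply: (abs_leBB Habs) IH; rewrite addnS /u /= addrAC subrr add0r (absN Habs).
  case: (Hu (n + k)%N) => _ _ H; apply: le_trans H _.
  by rewrite ler_wiXn2l ?(ltW d0) ?(ltW d1) // ltnS leq_addr.
have small e : 0 < e -> exists N, forall n, (N <= n)%N -> d ^+ n.+1 < e.
  have d01 : 0 <= d < 1 by rewrite ltW.
  by move=> /(geometric_small d01)[N HN]; exists N => n hn; apply: HN; apply: leqW.
have cauchy : cauchy_seq (abs := abs) u.
  move=> e /small[N HN]; exists N => m n hm hn.
  wlog mn : m n hm hn / (n <= m)%N.
    move=> H; have [/H|/ltnW/H] := leqP n m; first exact.
    by rewrite (absB Habs); apply.
  by rewrite -(subnKC mn); apply: le_lt_trans (dist _ _) _; apply: HN.
have [t Lt ut] := cL u (fun n => let: And3 h _ _ := Hu n in h) cauchy.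
have {}ut := (tends_toP Habs _ _).1 ut.
have tt0 : abs (t - t0) <= d.
  have [N HN] := ut d d0; apply: (@abs_leBB _ _ _ Habs _ _ (u N)).
    by rewrite (absB Habs) ltW // HN.
  by case: (Hu N).
exists t; split=> //; apply/(tends_toP Habs) => e e0.
have [N HN] := small e e0; have [N' HN'] := ut e e0.
exists (maxn N N' + q + 2)%N => n hn.
have [m nE hm] : exists2 m, n = (m + q + 2)%N & (maxn N N' <= m)%N.
  by exists (n - q - 2)%N; lia.
move: hm; rewrite geq_max => /andP[mN mN'].
case: (Hu m) => _ um0 Sm.
rewrite subr0 nE -[partial_sum c t _](subrK (partial_sum c (u m) (m + q + 2))).
apply: (abs_ltD Habs); last by apply: le_lt_trans Sm _; apply: HN.
apply: le_lt_trans (HN' m mN'); rewrite (absB Habs) /partial_sum -sumrB.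
apply: (abs_sum_le Habs) => // i _; rewrite -mulrBr absM.
rewrite -[leRHS]mul1r ler_pM // ?sub_exp_le //; try exact: close1.
have [->|i1] := eqVneq (i : nat) 1%N; first by rewrite c1 (abs1 Habs).
have [->//|iq] := eqVneq (i : nat) q.
by apply: le_trans (cd _ i1 iq) _; apply: ltW.
Qed.

(** A [q.-1]-th root of [e] is a nonzero root of [t - e^-1 * t ^+ q]. *)
Lemma one_unit_root (L : set F) q e :
  is_subfield L -> complete_in (abs := abs) L -> (1 < q)%N -> abs q%:R < 1 ->
  L e -> abs (e - 1) < 1 -> exists2 y, L y & y ^+ q.-1 = e.
Proof.
move=> HL cL q1 qs Le e1.
have q'1 : q != 1%N by rewrite gtn_eqF.
have ae : abs e = 1 by apply: (abs_unit_near Habs (abs1 Habs)); rewrite (absB Habs).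
have e0 : e != 0 by rewrite -(abs_eq0 Habs) ae oner_eq0.
(* The entry [2^-1] only makes [d] positive. *)
pose d := Num.max (2^-1) (Num.max (abs q%:R) (abs (e - 1))).
have d01 : 0 < d < 1.
  by rewrite lt_max !gt_max qs e1 invr_gt0 ltr0Sn invf_lt1 ?ltr1n.
have qd : abs q%:R <= d by rewrite !le_max lexx orbT.
have ed : abs (e - 1) <= d by rewrite !le_max lexx !orbT.
pose c i := if i == 1%N then 1 else if i == q then - e^-1 else 0.
have c1 : c 1%N = 1 by [].
have cqE : c q = - e^-1 by rewrite /c (negPf q'1) eqxx.
have c0 i : i != 1%N -> i != q -> c i = 0.
  by rewrite /c => /negPf -> /negPf ->.
have SE t N : (q < N)%N -> partial_sum c t N = t - e^-1 * t ^+ q.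
  move=> qN; rewrite (partial_sum_split _ _ (ltn_trans q1 qN) qN q'1) c1 cqE.
  rewrite mul1r mulNr big1 ?addr0 // => i /andP[i1 iq].
  by rewrite c0 // mul0r.
have /andP[d0 _] := d01.
have L1 := subfield1 HL.
have Lc i : L (c i).
  rewrite /c; case: eqP => // _; case: eqP => _; last exact: subfield0.
  by apply: subfieldN => //; apply: subfieldV.
have [|||||t [Lt t1 tt]] := series_root_exists HL cL Lc L1 qd d01 c1.
- by rewrite cqE (absN Habs) (absV Habs) ae invr1.
- by move=> i i1 iq; rewrite c0 // (abs0 Habs) ltW.
- move=> j; rewrite c0 ?(abs0 Habs) ?exprn_ge0 ?(ltW d0) //; apply/eqP; lia.
- by rewrite (abs1 Habs).
- rewrite SE; last by lia.
  have -> : 1 - e^-1 * 1 ^+ q = e^-1 * (e - 1) by rewrite expr1n mulr1 mulrBr mulVf // mulr1.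
  by rewrite absM (absV Habs) ae invr1 mul1r.
have t0 : t != 0.
  apply: contraTneq t1 => ->; rewrite sub0r (absN Habs) (abs1 Habs) -ltNge.
  by case/andP: d01.
exists t => //; have : t - e^-1 * t ^+ q = 0.
  apply/eqP; rewrite -(abs_eq0 Habs) eq_le abs_ge0 andbT leNgt; apply/negP => h.
  have [N HN] := (tends_toP Habs _ _).1 tt _ h.
  have := HN (maxn N q.+1) (leq_maxl _ _).
  by rewrite subr0 SE ?ltxx // leq_max leqnn orbT.
rewrite -{1}(prednK (ltnW q1)) exprS mulrCA -{1}[t]mulr1 -mulrBr => /eqP.
rewrite mulf_eq0 (negPf t0) subr_eq0 /= => /eqP E.
by apply: (mulfI (invr_neq0 e0)); rewrite -E mulVf.
Qed.

End Hensel.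

(** * Zeros of Eisenstein series *)

Section EisensteinSeries.

Context {R : realType} {F : closedFieldType} {abs : F -> R}.
Hypothesis Habs : absolute_value abs.
Variables (a : nat -> F) (q : nat) (w : F).
Hypotheses (q_gt1 : (1 < q)%N) (q_small : abs q%:R < 1).
Hypotheses (a0 : a 0%N = 0) (a1_neq0 : a 1%N != 0) (a1_small : abs (a 1%N) < 1).
Hypothesis a_le1 : forall i, abs (a i) <= 1.
Hypothesis a_small : forall i, (i < q)%N -> abs (a i) <= abs (a 1%N).
Hypothesis aq_unit : abs (a q) = 1.
Hypothesis wE : a q * w ^+ q.-1 = - a 1%N.

Let abs_ge0 := abs_ge0 Habs.
Let absM := absM Habs.
Let absX := absX Habs.

(** The change of variable [X = w * t] makes the coefficients of degree 1 and
   [q] opposite units; dividing by the first normalises it to 1. *)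
Definition rescaled i := a i * w ^+ i / (a 1%N * w).

Let q_neq1 : q != 1%N. Proof. by rewrite gtn_eqF. Qed.

Let aq_neq0 : a q != 0.
Proof. by rewrite -(abs_eq0 Habs) aq_unit oner_eq0. Qed.

Let w_neq0 : w != 0.
Proof.
apply: contra_neq a1_neq0 => w0; apply/eqP.
by rewrite -oppr_eq0 -wE w0 expr0n -subn1 subn_eq0 leqNgt q_gt1 mulr0.
Qed.

Lemma abs_uniformizerX : abs w ^+ q.-1 = abs (a 1%N).
Proof. by rewrite -(absN Habs (a _)) -wE absM aq_unit mul1r absX. Qed.

Lemma abs_uniformizer : abs w < 1.
Proof.
rewrite ltNge; apply/negP => w1; have := a1_small.
by rewrite -abs_uniformizerX ltNge exprn_ege1.
Qed.

Let w_gt0 : 0 < abs w. Proof. by rewrite (abs_gt0 Habs). Qed.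

Let a1_gt0 : 0 < abs (a 1%N). Proof. by rewrite (abs_gt0 Habs). Qed.

Lemma rescaled1 : rescaled 1 = 1.
Proof. by rewrite /rescaled expr1 divff // mulf_neq0. Qed.

Lemma rescaledq : rescaled q = -1.
Proof.
rewrite /rescaled -{2}(prednK (ltnW q_gt1)) exprSr mulrA wE !mulNr divff //.
by rewrite mulf_neq0.
Qed.

Lemma rescaled_tail j : abs (rescaled (q + 1 + j)) <= abs w ^+ j.+1.
Proof.
rewrite /rescaled absM (absV Habs) !absM absX ler_pdivrMr ?mulr_gt0 //.
rewrite -abs_uniformizerX -exprSr prednK ?(ltnW q_gt1) // -exprD.
have -> : (j.+1 + q = q + 1 + j)%N by lia.
by rewrite -[leRHS]mul1r ler_wpM2r // exprn_ge0.
Qed.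

Lemma rescaled_small i : i != 1%N -> i != q -> abs (rescaled i) <= abs w.
Proof.
move=> i1 iq; have [i0|i0] := eqVneq i 0%N.
  by rewrite i0 /rescaled a0 !mul0r (abs0 Habs).
have [h|h] := ltnP i q; last first.
  have -> : (i = q + 1 + (i - (q + 1)))%N.
    by rewrite subnKC // addn1 ltn_neqAle eq_sym iq.
  apply: le_trans (rescaled_tail _) _.
  by rewrite ler_iXnr // ltW // abs_uniformizer.
rewrite /rescaled absM (absV Habs) !absM absX ler_pdivrMr ?mulr_gt0 //.
rewrite mulrCA ler_pM ?exprn_ge0 //; first exact: a_small.
have -> : (i = i.-2.+2)%N by case: (i) i0 i1 => [|[]].
by rewrite -expr2 ler_wiXn2l // ltW // abs_uniformizer.
Qed.

Lemma partial_sum_rescaled t N :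
  partial_sum rescaled t N = (a 1%N * w)^-1 * partial_sum a (w * t) N.
Proof.
rewrite /partial_sum mulr_sumr; apply: eq_bigr => i _.
by rewrite /rescaled exprMn; ring.
Qed.

Let lift_bound x : Num.max (abs w) (abs q%:R) <= x ->
  (abs w <= x) * (abs q%:R <= x).
Proof. by rewrite ge_max => /andP[]. Qed.

(** After the change of variable [x = w * t] the series becomes, up to a
   scalar, [t - t ^+ q] plus a series divisible by [w]; so every nonzero root
   of [t - t ^+ q] lifts to a root. *)
Lemma zero_near_root_of_unity (L : set F) z :
  is_subfield L -> complete_in (abs := abs) L -> (forall i, L (a i)) -> L w ->
  L z -> z ^+ q.-1 = 1 ->
  exists x, [/\ L x, abs x < 1, abs (x / w - z) < 1
              & tends_to abs (partial_sum a x) 0].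
Proof.
move=> HL cL La Lw Lz z1; pose d := Num.max (abs w) (abs q%:R).
have [wd qd] := lift_bound (lexx d).
have d01 : 0 < d < 1 by rewrite lt_max gt_max w_gt0 abs_uniformizer q_small.
have az : abs z = 1.
  apply/eqP; rewrite -(@pexpr_eq1 _ _ q.-1) ?abs_ge0 ?ltn_predRL //.
  by rewrite -absX z1 (abs1 Habs).
have Lc i : L (rescaled i).
  by apply: (subfield_div HL); apply: (subfieldM HL) => //; apply: (subfieldX HL).
have [|||||t [Lt tz tt]] := series_root_exists Habs HL cL Lc Lz qd d01 rescaled1.
- by rewrite rescaledq (absN1 Habs).
- by move=> i i1 iq; apply: le_trans wd; apply: rescaled_small.
- move=> j; apply: le_trans (rescaled_tail j) _; apply: lerXn2r => //;
    by rewrite nnegrE // ltW //; case/andP: d01.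
- by rewrite az.
- rewrite addn2 (partial_sum_split _ _ _ _ q_neq1) //.
  rewrite rescaled1 rescaledq -[in z ^+ q](prednK (ltnW q_gt1)) exprS z1.
  rewrite mulN1r mul1r mulr1 subrr add0r; apply: (abs_sum_le Habs).
    by rewrite ltW //; case/andP: d01.
  move=> i /andP[i1 iq]; rewrite absM absX az expr1n mulr1.
  by apply: le_trans wd; apply: rescaled_small.
have {}tz : abs (t - z) < 1 by apply: le_lt_trans tz _; case/andP: d01.
exists (w * t); rewrite [w * t]mulrC mulfK //; split=> //.
- exact: (subfieldM HL).
- rewrite absM (abs_unit_near Habs az) ?mul1r ?abs_uniformizer //.
  by rewrite (absB Habs).
have := tends_to0_scale Habs (a 1%N * w) tt; congr tends_to.
apply/funext => N; rewrite partial_sum_rescaled mulVKf ?mulf_neq0 //.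
by rewrite mulrC.
Qed.

(** At a nonzero zero [x] the terms of degree 1 and [q] dominate all others,
   hence must nearly cancel. *)
Lemma zero_approx x : abs x < 1 -> x != 0 ->
  tends_to abs (partial_sum a x) 0 -> abs ((x / w) ^+ q.-1 - 1) < 1.
Proof.
move=> x1 x0 /(tends_toP Habs) Hx.
(* [M] bounds the terms of degree 1 and [q]; every other term is at most
   [abs x * M], and so is a far enough partial sum. *)
pose e := (x / w) ^+ q.-1; pose M := Num.max (abs (a 1%N * x)) (abs (x ^+ q)).
have x_gt0 : 0 < abs x by rewrite (abs_gt0 Habs).
have M0 : 0 < M by rewrite lt_max absM mulr_gt0.
have [N HN] := Hx (abs x * M) (mulr_gt0 x_gt0 M0).
pose n := maxn N q.+1; have {HN} : abs (partial_sum a x n) < abs x * M.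
  by have := HN n (leq_maxl _ _); rewrite subr0.
have qn : (q < n)%N by rewrite leq_max leqnn orbT.
rewrite (partial_sum_split _ _ (ltn_trans q_gt1 qn) qn q_neq1).
set S := \sum_(i < n | _) _ => HS.
have {}HS : abs (a 1%N * x + a q * x ^+ q) < M.
  have SM : abs S <= abs x * M.
    apply: (abs_sum_le Habs) => [|i /andP[i1 iq]]; first by rewrite ltW // mulr_gt0.
    have [->|i0] := eqVneq (i : nat) 0%N.
      by rewrite a0 mul0r (abs0 Habs) ltW // mulr_gt0.
    have [h|h] := ltnP i q.
      apply: (@le_trans _ _ (abs x * abs (a 1%N * x))).
        rewrite !absM mulrCA absX ler_pM ?exprn_ge0 //; first exact: a_small.
        have -> : (i : nat) = (i : nat).-2.+2.
          by case: (i : nat) i0 i1 => [|[]].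
        by rewrite -expr2 ler_wiXn2l // ltW.
      by rewrite ler_wpM2l // le_max lexx.
    apply: (@le_trans _ _ (abs x * abs (x ^+ q))).
      rewrite absM !absX -exprS -[leRHS]mul1r ler_pM ?exprn_ge0 //.
      by rewrite ler_wiXn2l //; [exact: ltW|rewrite ltn_neqAle eq_sym iq h].
    by rewrite ler_wpM2l // le_max lexx orbT.
  have xM : abs x * M < M by rewrite gtr_pMl.
  rewrite -[X in abs X](addrK S); apply: (abs_ltB Habs).
    exact: lt_trans HS xM.
  exact: le_lt_trans SM xM.
have eE : - (a q * x ^+ q) = a 1%N * x * e.
  rewrite /e expr_div_n -[in x ^+ q](prednK (ltnW q_gt1)) exprS.
  have wX0 : w ^+ q.-1 != 0 by rewrite expf_neq0.
  have -> : a 1%N = - (a q * w ^+ q.-1) by rewrite wE opprK.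
  by field.
have ME : M = abs (a 1%N * x) * Num.max 1 (abs e).
  rewrite maxr_pMr // mulr1 /M -absM -eE (absN Habs) [abs (a q * _)]absM aq_unit.
  by rewrite mul1r.
move: HS; rewrite -[a q * _]opprK eE ME -{1}[a 1%N * x]mulr1 -mulrBr absM.
have a1x : 0 < abs (a 1%N * x) by rewrite absM mulr_gt0.
rewrite ltr_pM2l // (absB Habs) lt_max => /orP[//|h].
by have := abs_dominant Habs h; rewrite (abs1 Habs) => e1; rewrite -e1.
Qed.

(** A field containing the lift [y] of each approximation of a zero [x]
   contains [x] itself, as zeros are unique in discs of radius less than 1. *)
Lemma zero_in_field (L : set F) x :
  is_subfield L -> complete_in (abs := abs) L -> (forall i, L (a i)) -> L w ->
  (forall z, z ^+ q.-1 = 1 -> L z) ->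
  abs x < 1 -> tends_to abs (partial_sum a x) 0 -> L x.
Proof.
move=> HL cL La Lw Lroots x1 xx.
have [->|x0] := eqVneq x 0; first exact: subfield0.
have xw := zero_approx x1 x0 xx.
have q1 : (0 < q.-1)%N by rewrite ltn_predRL.
have [z z1 xz] := near_root_of_unity Habs q1 xw.
have [y [Ly y1 yz yy]] := zero_near_root_of_unity HL cL La Lw (Lroots z z1) z1.
suff -> : x = y by [].
apply: (mulIf (invr_neq0 w_neq0)).
have az : abs z = 1.
  by apply/eqP; rewrite -(@pexpr_eq1 _ _ q.-1) ?abs_ge0 // -absX z1 (abs1 Habs).
have unit u : abs (u - z) < 1 -> abs u <= 1.
  by move=> h; rewrite (abs_unit_near Habs az) // (absB Habs).
(* [x / w] and [y / w] are both close to [z], so [d] is less than 1. *)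
pose d := Num.max (abs (x / w - y / w)) (Num.max (abs w) (abs q%:R)).
have [wd qd] : (abs w <= d) * (abs q%:R <= d).
  by apply: lift_bound; rewrite le_max lexx orbT.
have zero u : tends_to abs (partial_sum a u) 0 ->
    tends_to abs (partial_sum rescaled (u / w)) 0.
  move=> /(tends_to0_scale Habs (a 1%N * w)^-1); congr tends_to.
  by apply/funext => N; rewrite partial_sum_rescaled [w * _]mulrC divfK.
apply: (series_root_unique Habs qd _ rescaled1) => //.
- rewrite !gt_max abs_uniformizer q_small !andbT.
  by apply: (abs_ltBB Habs xz); rewrite (absB Habs).
- by rewrite rescaledq (absN1 Habs).
- by move=> i i1 iq; apply: le_trans wd; apply: rescaled_small.
- exact: unit.
- exact: unit.
- by rewrite le_max lexx.
- exact: zero.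
- exact: zero.
Qed.

(** For a zero [x] the quotient [t = x / w] is nearly a root of unity and
   [t ^+ q.-1] does not involve [w]; extracting its root recovers [t]. *)
Lemma uniformizer_in_field (L : set F) x :
  is_subfield L -> complete_in (abs := abs) L -> L (a 1%N) -> L (a q) ->
  (forall z, z ^+ q.-1 = 1 -> L z) ->
  abs x < 1 -> x != 0 -> tends_to abs (partial_sum a x) 0 -> L x -> L w.
Proof.
move=> HL cL La1 Laq Lroots x1 x0 xx Lx.
have q1 : (0 < q.-1)%N by rewrite ltn_predRL.
pose t := x / w; have t0 : t != 0 by rewrite mulf_neq0 ?invr_eq0.
have Lt : L (t ^+ q.-1).
  have -> : t ^+ q.-1 = x ^+ q.-1 * (a q / - a 1%N).
    rewrite -wE /t expr_div_n; field.
    by rewrite aq_neq0 expf_neq0.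
  apply: (subfieldM HL); first exact: (subfieldX HL).
  by apply: (subfield_div HL) => //; apply: (subfieldN HL).
have [y Ly yE] := one_unit_root Habs HL cL q_gt1 q_small Lt (zero_approx x1 x0 xx).
have y0 : y != 0 by move: (expf_neq0 q.-1 t0); rewrite -yE expf_eq0 q1.
have Lty : L (t / y).
  by apply: Lroots; rewrite expr_div_n yE divff // expf_neq0.
have -> : w = x / (t / y * y) by rewrite divfK // /t; field; rewrite w_neq0.
by apply: (subfield_div HL) => //; apply: (subfieldM HL).
Qed.

End EisensteinSeries.

(** * Fermat's theorem in residue fields *)

Section ResidueField.

Context {R : realType} {F : fieldType} {abs : F -> R}.
Hypothesis Habs : absolute_value abs.

Let absM := absM Habs.

Lemma prod_near (I : Type) (r : seq I) (P : pred I) (x y : I -> F) :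
  (forall i, P i -> abs (x i) <= 1) -> (forall i, P i -> abs (y i) <= 1) ->
  (forall i, P i -> abs (x i - y i) < 1) ->
  abs (\prod_(i <- r | P i) x i - \prod_(i <- r | P i) y i) < 1.
Proof.
move=> x1 y1 xy; pose Q u v := [/\ abs u <= 1, abs v <= 1 & abs (u - v) < 1].
suff [] : Q (\prod_(i <- r | P i) x i) (\prod_(i <- r | P i) y i) by [].
apply: (big_rec2 Q) => [|i u v Pi [u1 v1 uv]].
  by rewrite /Q subrr (abs1 Habs) (abs0 Habs) lexx ltr01.
split; rewrite ?absM ?mulr_ile1 ?(abs_ge0 Habs) ?x1 ?y1 //.
have -> : x i * u - y i * v = x i * (u - v) + (x i - y i) * v by ring.
apply: (abs_ltD Habs); rewrite absM.
  apply: le_lt_trans uv; rewrite ler_piMl ?(abs_ge0 Habs) //; exact: x1.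
by apply: le_lt_trans (xy i Pi); rewrite ler_piMr ?(abs_ge0 Habs).
Qed.

(** Fermat's little theorem in a residue field with representatives [r a]:
   multiplication by [u] permutes the nonzero classes, so the product of
   these classes equals its multiple by [u ^+ #|A|.-1]. *)
Lemma residue_fermat (A : finType) (r : A -> F) (a0 : A) u :
  r a0 = 0 -> (forall a, abs (r a) <= 1) ->
  (forall a b, abs (r a - r b) < 1 -> a = b) ->
  abs u = 1 -> (forall a, exists b, abs (u * r a - r b) < 1) ->
  abs (u ^+ #|A|.-1 - 1) < 1.
Proof.
move=> r0 r1 r_inj u1 /choice[s Hs].
have r_unit a : a != a0 -> abs (r a) = 1.
  move=> aa0; apply/eqP; rewrite eq_le r1 leNgt; apply: contra_neqN aa0 => h.
  by apply: r_inj; rewrite r0 subr0.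
have s_inj : injective s.
  move=> a b sab; apply: r_inj; rewrite -[abs _]mul1r -{1}u1 -absM mulrBr.
  by apply: (abs_ltBB Habs (Hs a)); rewrite sab (absB Habs).
have s0 : s a0 = a0.
  by apply: r_inj; have := Hs a0; rewrite r0 mulr0 (absB Habs).
have sE a : (s a != a0) = (a != a0) by rewrite -{1}s0 (inj_eq s_inj).
pose P := \prod_(a | a != a0) r a.
have P1 : abs P = 1.
  by rewrite /P (abs_prod Habs) big1 // => a; apply: r_unit.
have := @prod_near _ (index_enum A) (fun a => a != a0)
   (fun a => u * r a) (fun a => r (s a)).
have -> : \prod_(a | a != a0) r (s a) = P.
  by rewrite /P [RHS](reindex_inj s_inj); apply: eq_bigl => a; rewrite sE.
rewrite big_split /= prodr_const -/P -{2}[P]mul1r -mulrBl absM P1 mulr1.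
rewrite cardC1 => -> // a _; first by rewrite absM u1 mul1r.
Qed.

End ResidueField.

(** * Digits of p-adic integers *)

Section PadicField.

Context {R : realType} {p : nat} {F : fieldType} {abs : F -> R}.
Hypothesis p_pr : prime p.
Hypothesis Hp : is_padic_field p abs.

Let Habs : absolute_value abs. Proof. by case: Hp. Qed.

Lemma abs_p_lt1 : abs p%:R < 1.
Proof.
case: Hp => _ H _ _; rewrite H ?prime_gt0 // logn_prime // eqxx expr1.
by rewrite invf_lt1 ?ltr0n ?ltr1n ?prime_gt0 ?prime_gt1.
Qed.

Lemma abs_nat_coprime m : coprime p m -> abs m%:R = 1.
Proof.
move=> pm; case: Hp => _ H _ _.
have m0 : (0 < m)%N.
  by rewrite lt0n; apply: contraTneq pm => ->; rewrite /coprime gcdn0 gtn_eqF ?prime_gt1.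
by rewrite H // logn_coprime // expr0 invr1.
Qed.

Lemma abs_int_coprime (z : int) : coprime p `|z| -> abs z%:~R = 1.
Proof.
move=> h; rewrite -(abs_nat_coprime h).
by case: z {h} => n //=; rewrite NegzE mulrNz (absN Habs).
Qed.

Lemma abs_int_dvd (z : int) : (p %| z)%Z -> abs z%:~R < 1.
Proof.
move=> /dvdzP[y ->]; rewrite intrM (absM Habs); apply: le_lt_trans abs_p_lt1.
by rewrite ler_piMl ?(abs_ge0 Habs) ?(abs_int_le1 Habs).
Qed.

(** Distinct digits differ by a number prime to [p], hence by a unit. *)
Lemma nat_digit_unique i j :
  (i < p)%N -> (j < p)%N -> abs (i%:R - j%:R) < 1 -> i = j.
Proof.
wlog ij : i j / (i <= j)%N.
  move=> H ip jp; have [h|/ltnW h] := leqP i j; first exact: H.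
  by rewrite (absB Habs) => ?; apply/esym/H.
move=> ip jp; rewrite (absB Habs) -natrB // => h.
apply/eqP; rewrite eqn_leq ij -subn_eq0; apply: contraTT h => d0.
rewrite -leNgt abs_nat_coprime // prime_coprime //.
by rewrite gtnNdvd ?lt0n // (leq_ltn_trans (leq_subr _ _)).
Qed.

(** The residue field of the p-adic numbers is the prime field: by density it
   suffices to reduce a rational number, whose denominator is a unit. *)
Lemma nat_digit x : abs x <= 1 -> exists2 k, (k < p)%N & abs (x - k%:R) < 1.
Proof.
move=> x1; case: (Hp) => _ _ dens _; have [r xr] := dens x 1 ltr01.
have r1 : abs (ratr r) <= 1.
  by rewrite -[ratr r](subKr x); apply: (abs_leB Habs) => //; apply: ltW.
pose nm := numq r; pose d := denq r.
have rE : ratr r = nm%:~R / d%:~R :> F by [].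
have cop : coprime `|nm| `|d| by apply: coprime_num_den.
have pd : coprime p `|d|.
  rewrite prime_coprime //; apply/negP => pd.
  have pn : coprime p `|nm|.
    rewrite prime_coprime //; apply/negP => pn.
    have := dvdn_gcd p `|nm| `|d|; rewrite pn pd (eqP cop) dvdn1.
    by rewrite gtn_eqF ?prime_gt1.
  move: r1; rewrite rE (absM Habs) (absV Habs) (abs_int_coprime pn) mul1r.
  have d1 : abs d%:~R < 1 by apply: abs_int_dvd.
  rewrite invf_le1 ?leNgt ?d1 // (abs_gt0 Habs) -(abs_eq0 Habs).
  have d0 : (0 < `|d|)%N by rewrite absz_gt0 denq_neq0.
  have -> : abs d%:~R = abs `|d|%N%:R :> R by rewrite -{1}[d]gez0_abs ?denq_ge0.
  case: Hp => _ -> // _ _; rewrite invr_eq0 expf_neq0 // pnatr_eq0.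
  by rewrite -lt0n prime_gt0.
have d1 : abs d%:~R = 1 by apply: abs_int_coprime.
have p0 : (p : int) != 0 by rewrite -lt0n prime_gt0.
have [s [t st]] := Bezoutz p d.
have {}st : s * p + t * d = 1 by rewrite st /gcdz absz_nat (eqP pd).
(* [t] inverts the denominator modulo [p]. *)
pose k := (t * nm %% p)%Z.
have kE : k = `|k|%N by rewrite gez0_abs // modz_ge0.
exists `|k|%N; first by rewrite -ltz_nat -kE ltz_pmod // ltz_nat prime_gt0.
apply: (abs_ltBB Habs xr).
have -> : ratr r - `|k|%N%:R = (nm - k * d)%:~R / d%:~R :> F.
  have dn : d%:~R != 0 :> F by rewrite -(abs_eq0 Habs) d1 oner_eq0.
  rewrite rE [in RHS]kE intrB intrM; field.
  exact: dn.
rewrite (absM Habs) (absV Habs) d1 invr1 mulr1; apply: abs_int_dvd.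
apply/dvdzP; exists (s * nm + (t * nm %/ p)%Z * d).
have kD : k = t * nm - (t * nm %/ p)%Z * p.
  by rewrite {1}(divz_eq (t * nm) p) -/k; ring.
by rewrite kD -{1}[nm]mul1r -st; ring.
Qed.

End PadicField.

(** * Extensions of the p-adic numbers and torsion fields *)

Section TorsionFields.

Context {R : realType} {p : nat} {Qp : fieldType} {K : fieldExtType Qp}.
Context {C : closedFieldType} {emb : {rmorphism K -> C}} {abs : C -> R}.
Hypotheses (p_pr : prime p) (HC : padic_closure emb abs p).

Let Habs : absolute_value abs. Proof. by case: HC. Qed.

Let HQp : is_padic_field p (fun a : Qp => abs (base_emb emb a)).
Proof. by case: HC. Qed.

Let base_emb_nat k : base_emb emb k%:R = k%:R.
Proof. by rewrite /base_emb -in_algE !rmorph_nat. Qed.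

Lemma range_rmorph_subfield (E : fieldType) (g : {rmorphism E -> C}) :
  is_subfield (range g).
Proof.
apply/is_subfieldP; split; first by exists 1; rewrite ?rmorph1.
  by move=> _ _ [x _ <-] [y _ <-]; exists (x - y); rewrite ?rmorphB.
by move=> _ _ [x _ <-] [y _ <-]; exists (x / y); rewrite ?fmorph_div.
Qed.

Lemma base_subfield : is_subfield (range (base_emb emb)).
Proof. exact: (range_rmorph_subfield (emb \o in_alg K)). Qed.

Lemma base_complete : complete_in (abs := abs) (range (base_emb emb)).
Proof.
move=> u uQ; have /choice[v vE] n : exists v, base_emb emb v = u n.
  by have [v _ <-] := uQ n; exists v.
have BB x y : base_emb emb (x - y) = base_emb emb x - base_emb emb y.
  by rewrite /base_emb scalerBl rmorphB.
move=> Hu; case: HQp => _ _ _ cQ; have [|l Hl] := cQ v.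
  by move=> e /Hu[N HN]; exists N => m n hm hn; rewrite BB !vE; apply: HN.
exists (base_emb emb l); first by exists l.
apply/(tends_toP Habs) => e e0.
have HvE : absolute_value (fun a : Qp => abs (base_emb emb a)) by case: HQp.
have [N HN] := (tends_toP HvE _ _).1 Hl e e0.
by exists N => n /HN; rewrite BB vE.
Qed.

Lemma algebraic_over_base (x : C) : exists P : {poly C},
  [/\ forall i, range (base_emb emb) P`_i, P != 0 & root P x].
Proof.
case: HC => _ _ /(_ x)[P P0 Px]; exists (map_poly (emb \o in_alg K) P).
split=> // [i|]; last by rewrite map_poly_eq0.
by rewrite coef_map; exists P`_i.
Qed.

Lemma base_sub : range (base_emb emb) `<=` range emb.
Proof. by move=> _ [a _ <-]; exists a%:A. Qed.

Lemma emb_subfield : is_subfield (range emb).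
Proof. exact: range_rmorph_subfield. Qed.

(** [K] is the span over the p-adic numbers of a basis. *)
Lemma emb_complete : complete_in (abs := abs) (range emb).
Proof.
pose vs := [seq emb b | b <- vbasis {:K}].
have -> : range emb = lspan (range (base_emb emb)) vs.
  have [W0 WD WZ] := lspan_submodule vs base_subfield.
  apply/seteqP; split; last first.
    apply: lspan_sub => [|_ /mapP[b _ ->]]; last by exists b.
    exact: subfield_submodule emb_subfield base_sub.
  move=> _ [x _ <-]; rewrite (coord_vbasis (memvf x)) rmorph_sum.
  apply: (big_ind (lspan (range (base_emb emb)) vs)) => // i _.
  rewrite -mulr_algl rmorphM; apply: (WZ); first by exists (coord (vbasis fullv) i x).
  by apply: (mem_lspan base_subfield); apply: map_f; rewrite mem_nth ?size_tuple.
apply: lspan_complete => //; [exact: base_subfield|exact: base_complete].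
Qed.

Lemma unity_adjoin_complete m : (0 < m)%N ->
  complete_in (abs := abs) (adjoin (range emb) (roots_of_unity m)).
Proof.
move=> m0; have [r rE] := closed_field_poly_normal ('X^m - 1 : {poly C}).
rewrite (monicP (monic_Xn_sub_1 C m0)) scale1r in rE.
have -> : roots_of_unity m = [set x | x \in r].
  apply/seteqP; split=> x /=; rewrite /roots_of_unity /= /root_of_unity => H.
    by rewrite -root_prod_XsubC -rE.
  by rewrite rE root_prod_XsubC.
apply: (adjoin_complete Habs emb_subfield base_subfield base_sub).
  exact: algebraic_over_base.
exact: emb_complete.
Qed.

Lemma abs_prime_lt1 : abs p%:R < 1.
Proof. by rewrite -base_emb_nat; apply: (abs_p_lt1 p_pr HQp). Qed.

Lemma residue_degree_gt0 f : has_residue_degree emb abs f -> (0 < f)%N.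
Proof.
case: f => // -[e [_ H _]]; have [|c [_]] := H 1.
  by rewrite /integersK /absK /= rmorph1 (abs1 Habs).
by rewrite big_ord0 subr0 /maxidealK /absK /= rmorph1 (abs1 Habs) ltxx.
Qed.

(** Representatives of the residue field of [K]: the combinations of lifts of
   a basis with coefficients [0, ..., p - 1]. *)
Lemma unit_fermat f (u : K) : has_residue_degree emb abs f ->
  absK emb abs u = 1 -> abs (emb u ^+ (p ^ f).-1 - 1) < 1.
Proof.
move=> [e [e_int e_gen e_free]] u1.
pose A := {ffun 'I_f -> 'I_p}; pose r (a : A) := \sum_i (a i)%:R *: e i.
have p0 : (0 < p)%N by rewrite prime_gt0.
have Hcard : #|A| = (p ^ f)%N by rewrite card_ffun !card_ord.
have absZ (c : Qp) x : absK emb abs (c *: x) = abs (base_emb emb c) * absK emb abs x.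
  by rewrite /absK -mulr_algl rmorphM (absM Habs).
have nat1 k : abs (base_emb emb k%:R) <= 1.
  by rewrite base_emb_nat; apply: (abs_nat_le1 Habs).
have r_int a : absK emb abs (r a) <= 1.
  rewrite /absK rmorph_sum; apply: (abs_sum_le Habs) => // i _.
  have := absZ (a i)%:R (e i); rewrite /absK => ->.
  by rewrite mulr_ile1 ?(abs_ge0 Habs) ?nat1 //; exact: e_int.
rewrite -Hcard; apply: (@residue_fermat _ _ _ Habs _ (fun a => emb (r a))
    [ffun=> Ordinal p0]) => //.
- by rewrite /r big1 ?rmorph0 // => i _; rewrite ffunE scale0r.
- move=> a b ab; apply/ffunP => i; apply/val_inj.
  pose c i : Qp := (a i)%:R - (b i)%:R.
  suff ci : maxidealK emb abs (c i)%:A.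
    exact: (nat_digit_unique p_pr HQp (ltn_ord _) (ltn_ord _) ci).
  apply: e_free => [j|].
    rewrite /integersK /absK /= /c scalerBl rmorphB.
    by apply: (abs_leB Habs); apply: nat1.
  move: ab; rewrite -rmorphB /r -sumrB /maxidealK /absK /=.
  by under eq_bigr do rewrite -scalerBl.
move=> a; have ua : integersK emb abs (u * r a).
  rewrite /integersK /absK /= rmorphM (absM Habs) [abs (emb u)]u1 mul1r.
  exact: r_int.
have [c [c_int xc]] := e_gen _ ua.
have /choice[k Hk] i : exists k : 'I_p, abs (base_emb emb (c i - k%:R)) < 1.
  have [k kp ck] := nat_digit p_pr HQp (c_int i).
  by exists (Ordinal kp).
exists [ffun i => k i]; apply: (abs_ltBB Habs (y := emb (\sum_i c i *: e i))).
  by rewrite -rmorphM -rmorphB.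
rewrite -rmorphB /r -sumrB rmorph_sum.
elim/big_ind: _ => [|x y|i _]; first by rewrite (abs0 Habs).
  exact: (abs_ltD Habs).
rewrite ffunE -scalerBl [X in X < _]absZ; apply: le_lt_trans (Hk i).
by rewrite ler_piMr ?(abs_ge0 Habs) //; exact: e_int.
Qed.

Lemma closed_root (c : C) m : (0 < m)%N -> exists v, v ^+ m = c.
Proof.
move=> m0; have /closed_rootP[v] : size ('X^m - c%:P) != 1%N.
  by rewrite size_XnsubC // eqSS -lt0n.
by rewrite rootE !hornerE subr_eq0 => /eqP <-; exists v.
Qed.

(** An approximate [q.-1]-th root of [emb u] can be taken among the roots of
   unity: if [v ^+ q.-1 = emb u], then [v ^+ (q.-1 * (p ^ f).-1)] is close to
   1.  The correction is a one-unit. *)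
Lemma unit_root (L : set C) f q (u : K) :
  has_residue_degree emb abs f -> (1 < q)%N -> abs q%:R < 1 ->
  is_subfield L -> complete_in (abs := abs) L -> range emb `<=` L ->
  roots_of_unity ((q - 1) * (p ^ f - 1)) `<=` L ->
  absK emb abs u = 1 -> exists2 y, L y & y ^+ q.-1 = emb u.
Proof.
move=> hf q1 qs HL cL KL rL u1.
have q'1 : (0 < q.-1)%N by rewrite ltn_predRL.
have [v vE] := closed_root (emb u) q'1.
have m0 : (0 < q.-1 * (p ^ f).-1)%N.
  rewrite muln_gt0 q'1 ltn_predRL -(exp1n f) ltn_exp2r ?prime_gt1 //.
  exact: residue_degree_gt0.
have [|z z1 vz] := near_root_of_unity Habs (v := v) m0.
  by rewrite exprM vE; apply: unit_fermat.
have Lz : L z.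
  apply: rL; rewrite /roots_of_unity /= !subn1.
  by apply/unity_rootP.
have az : abs z = 1.
  by apply/eqP; rewrite -(@pexpr_eq1 _ _ _ m0) ?(abs_ge0 Habs) // -(absX Habs) z1 (abs1 Habs).
have z0 : z != 0 by rewrite -(abs_eq0 Habs) az oner_eq0.
have near1 : abs (v / z - 1) < 1.
  have -> : v / z - 1 = (v - z) / z by rewrite mulrBl divff.
  by rewrite (absM Habs) (absV Habs) az invr1 mulr1.
have vz1 : abs (v / z) <= 1.
  rewrite (abs_unit_near Habs (abs1 Habs)) //; by rewrite (absB Habs).
have Le : L ((v / z) ^+ q.-1).
  rewrite expr_div_n vE; apply: (subfield_div HL); last exact: (subfieldX HL).
  by apply: KL; exists u.
have [|y Ly yE] := one_unit_root Habs HL cL q1 qs Le.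
  rewrite -(expr1n _ q.-1); apply: le_lt_trans near1.
  by apply: (sub_exp_le Habs) => //; rewrite (abs1 Habs).
exists (y * z); first exact: (subfieldM HL).
by rewrite exprMn yE expr_div_n vE divfK // expf_neq0.
Qed.

Lemma generator_neq0 (pi : K) : generates_maxideal emb abs pi -> pi != 0.
Proof.
move=> H; apply/eqP => pi0; have : maxidealK emb abs p%:R.
  by rewrite /maxidealK /absK /= rmorph_nat abs_prime_lt1.
rewrite H pi0 => -[y _]; rewrite mul0r => /esym pE.
have : abs (base_emb emb p%:R) != 0.
  case: HQp => _ -> //; last exact: prime_gt0.
  by rewrite invr_eq0 expf_neq0 // pnatr_eq0 -lt0n prime_gt0.
by rewrite base_emb_nat -(rmorph_nat emb) pE rmorph0 (abs0 Habs) eqxx.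
Qed.

Lemma generator_lt1 (pi : K) :
  generates_maxideal emb abs pi -> absK emb abs pi < 1.
Proof.
move=> H; suff : maxidealK emb abs pi by [].
rewrite H; exists 1; rewrite ?mulr1 // /integersK /absK /=.
by rewrite rmorph1 (abs1 Habs).
Qed.

Lemma generator_max (pi x : K) : generates_maxideal emb abs pi ->
  absK emb abs x < 1 -> absK emb abs x <= absK emb abs pi.
Proof.
move=> H hx; have : maxidealK emb abs x by [].
rewrite H => -[y y1 <-]; rewrite /absK rmorphM (absM Habs).
by rewrite ler_piMr ?(abs_ge0 Habs).
Qed.

(** The height condition in terms of [pi]: a coefficient that is not a unit is
   divisible by [pi], so the Newton polygon of [[pi](X) / X] starts with a
   single segment, from degree 0 to degree [p ^ h - 1]. *)
Lemma multiplication_series (pi : K) (G : fps K 2) (br : K -> fps K 1) h :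
  generates_maxideal emb abs pi -> unramified_law emb abs pi G br ->
  has_height emb abs p (br pi) h ->
  let a i := emb (fps_coef (br pi) i) in
  [/\ a 0%N = 0, a 1%N = emb pi, forall i, abs (a i) <= 1,
      forall i, (i < p ^ h)%N -> abs (a i) <= abs (emb pi)
    & abs (a (p ^ h)%N) = 1].
Proof.
move=> Hpi [_ [Hbr _ _ _]] [q1 aq a_nonunit] a.
have [|[a_int a0 _] a1] := Hbr pi.
  by split; [apply: memv_adjoin|apply: ltW; apply: generator_lt1].
have a_le1 i : abs (a i) <= 1 by apply: a_int.
split=> // [||i iq]; [by rewrite /a a0 rmorph0|by rewrite /a a1|].
have [i2|i2] := leqP 2 i.
  apply: (generator_max Hpi); rewrite lt_neqAle [_ <= 1]a_le1 andbT.
  by apply/eqP; apply: a_nonunit; rewrite i2.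
case: i i2 iq => [|[|//]] _ _; first by rewrite /a a0 rmorph0 (abs0 Habs) (abs_ge0 Habs).
by rewrite /a a1.
Qed.

End TorsionFields.

(** * Equality of the torsion fields *)

Theorem theorem1p1 (R : realType) (p : nat) (Qp : fieldType)
    (K : fieldExtType Qp) (C : closedFieldType)
    (emb : {rmorphism K -> C}) (abs : C -> R)
    (hp : prime p) (hodd : odd p) (hC : padic_closure emb abs p)
    (f : nat) (hf : has_residue_degree emb abs f)
    (n : nat) (hn : (2 <= n)%N)
    (pi : 'I_n -> K) (hpi : forall i, generates_maxideal emb abs (pi i))
    (F : 'I_n -> fps K 2) (br : 'I_n -> K -> fps K 1)
    (hF : forall i, unramified_law emb abs (pi i) (F i) (br i))
    (h : nat) (h_gt0 : (0 < h)%N)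
    (hh : forall i, has_height emb abs p (br i (pi i)) h)
    (hdvd : (h %| f)%N) :
  let q := (p ^ h)%N in
  let K1 := adjoin (range emb) (roots_of_unity ((q - 1) * (p ^ f - 1))) in
  let T i := torsion emb abs (br i (pi i)) in
  (forall i j, adjoin K1 (T i) = adjoin K1 (T j)) /\
  (forall i, adjoin K1 (T i) = adjoin K1 (\bigcup_i T i)).
Proof.
move=> q K1 T.
have Habs : absolute_value abs by case: hC.
have q_gt1 : (1 < q)%N by case: (hh (Ordinal (ltnW hn))).
have q_small : abs q%:R < 1.
  rewrite natrX (absX Habs) exprn_ilt1 ?(abs_ge0 Habs) -?lt0n //.
  exact: (abs_prime_lt1 hp hC).
have q'_gt0 : (0 < q.-1)%N by rewrite ltn_predRL.
(* The law [i0] serves as reference: [w ^+ q.-1 = - pi i0]. *)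
pose i0 := Ordinal (ltnW hn).
pose a i j := emb (fps_coef (br i (pi i)) j).
have Ha i := multiplication_series hC (hpi i) (hF i) (hh i).
have K1_sub : is_subfield K1 by apply: adjoin_subfield.
have KK1 : range emb `<=` K1 by apply: sub_adjoinl.
have rootsK1 : roots_of_unity ((q - 1) * (p ^ f - 1)) `<=` K1.
  exact: sub_adjoinr.
have m_gt0 : (0 < (q - 1) * (p ^ f - 1))%N.
  rewrite muln_gt0 !subn_gt0 q_gt1 -(exp1n f) ltn_exp2r ?prime_gt1 //.
  exact: residue_degree_gt0 hC _ hf.
have K1_complete : complete_in (abs := abs) K1
  by apply: unity_adjoin_complete hC _ m_gt0.
have K1_roots z : z ^+ q.-1 = 1 -> K1 z.
  move=> z1; apply: sub_adjoinr; rewrite /roots_of_unity /=; apply/unity_rootP.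
  by rewrite exprM subn1 z1 expr1n.
have adj_complete z : complete_in (abs := abs) (adjoin K1 [set z]).
  have QK1 : range (base_emb emb) `<=` K1 by move=> x /base_sub/KK1.
  exact: (adjoin1_complete Habs K1_sub (base_subfield (emb := emb)) QK1
    (algebraic_over_base hC) K1_complete).
have [w wE] := closed_root (- emb (pi i0)) q'_gt0.
set L := adjoin K1 [set w].
have pi_neq0 i : emb (pi i) != 0 by rewrite fmorph_eq0; apply: (generator_neq0 hp hC).
have abs_pi i j : abs (emb (pi i)) <= abs (emb (pi j)).
  apply: (generator_max hC (hpi j)); exact: (generator_lt1 hC (hpi i)).
have Hw i : exists2 y, K1 y & y != 0 /\ a i q * (w * y) ^+ q.-1 = - a i 1%N.
  have [_ a1 _ _ aq] := Ha i.
  have aq0 : a i q != 0 by rewrite -(abs_eq0 Habs) aq oner_eq0.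
  (* The quotient of [- pi i / a i q] by [- pi i0]. *)
  pose u := pi i / (pi i0 * fps_coef (br i (pi i)) q).
  have uE : emb u = emb (pi i) / (emb (pi i0) * a i q).
    by rewrite /u fmorph_div rmorphM.
  have u1 : absK emb abs u = 1.
    rewrite /absK uE (absM Habs) (absV Habs) (absM Habs) aq mulr1.
    have -> : abs (emb (pi i)) = abs (emb (pi i0)).
      by apply/eqP; rewrite eq_le !abs_pi.
    by rewrite divff // (abs_eq0 Habs).
  have [y K1y yE] := unit_root hp hC hf q_gt1 q_small K1_sub K1_complete KK1
    rootsK1 u1.
  exists y => //; split.
    apply/eqP => y0; move: u1; rewrite /absK -yE y0 expr0n eqn0Ngt q'_gt0.
    by rewrite (abs0 Habs) => /esym/eqP; rewrite oner_eq0.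
  by rewrite exprMn wE yE uE /a a1; field; rewrite aq0 pi_neq0.
have aK i j : K1 (a i j) by apply: KK1; exists (fps_coef (br i (pi i)) j).
have L_sub : is_subfield L by apply: adjoin_subfield.
have K1L : K1 `<=` L by apply: sub_adjoinl.
have Lw : L w by apply: sub_adjoinr.
have L_complete : complete_in (abs := abs) L by apply: adj_complete.
have T_sub i : T i `<=` L.
  have [y K1y [y0 yE]] := Hw i; have [a0 a1 a_le1 a_small aq] := Ha i.
  move=> x [x1 xx]; apply: (zero_in_field Habs (a := a i) (q := q) (w := w * y)) => //.
  - by rewrite /a a1.
  - rewrite /a a1; exact: (generator_lt1 hC (hpi i)).
  - by rewrite /a a1.
  - by move=> j; apply: K1L.
  - by apply: (subfieldM L_sub) => //; apply: K1L.
  - by move=> z /K1_roots/K1L.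
have w_in i : adjoin K1 (T i) w.
  have [y K1y [y0 yE]] := Hw i; have [a0 a1 a_le1 a_small aq] := Ha i.
  have a1_neq0 : a i 1%N != 0 by rewrite /a a1.
  have a1_small : abs (a i 1%N) < 1 by rewrite /a a1; exact: (generator_lt1 hC (hpi i)).
  have a_small' j : (j < q)%N -> abs (a i j) <= abs (a i 1%N).
    by rewrite /a a1; apply: a_small.
  have Lwy : L (w * y) by apply: (subfieldM L_sub) => //; apply: K1L.
  have [x [_ x1 xz xx]] := zero_near_root_of_unity Habs q_gt1 q_small a0 a1_neq0
    a1_small a_le1 a_small' aq yE L_sub L_complete (fun j => K1L _ (aK i j)) Lwy
    (subfield1 L_sub) (expr1n _ _).
  have x0 : x != 0.
    by apply: contraTneq xz => ->; rewrite mul0r sub0r (absN Habs) (abs1 Habs) ltxx.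
  have K1x : K1 `<=` adjoin K1 [set x] by apply: sub_adjoinl.
  have xsub := adjoin_subfield K1 [set x].
  have wy : adjoin K1 [set x] (w * y).
    apply: (uniformizer_in_field Habs q_gt1 q_small a0 a1_neq0 a_le1
      a_small' aq yE xsub (adj_complete x) _ _ _ x1 x0 xx).
    - exact: K1x.
    - exact: K1x.
    - by move=> z /K1_roots/K1x.
    - exact: sub_adjoinr.
  have : adjoin K1 [set x] w.
    by rewrite -[w](mulfK y0); apply: (subfield_div xsub) => //; apply: K1x.
  apply: adjoin_sub; [exact: adjoin_subfield|exact: sub_adjoinl|].
  by move=> _ ->; apply: sub_adjoinr; split.
have adjE S : S `<=` L -> adjoin K1 S w -> adjoin K1 S = L.
  move=> SL Sw; apply/seteqP; split; first exact: adjoin_sub.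
  apply: adjoin_sub; [exact: adjoin_subfield|exact: sub_adjoinl|].
  by move=> _ ->.
have TE i : adjoin K1 (T i) = L by apply: adjE.
split=> [i j|i]; rewrite !TE //; apply/esym/adjE => [x [j _]|]; first exact: T_sub.
have := w_in i; apply: adjoin_sub; [exact: adjoin_subfield|exact: sub_adjoinl|].
by move=> x Tx; apply: sub_adjoinr; exists i.
Qed.
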